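(* Let $r\geq 2$ and $n\geq 65r^2$ be integers. Let $G$ be a co-connected $K_{r+1}$-free graph of order $n$. Then $\lambda(G)\leq\lambda(T_r^{-}(n))$, with equality if and only if $G=T_r^{-}(n)$ (that is, $G$ is isomorphic to $T_r^{-}(n)$).
   Context: All graphs are finite and simple. $\lambda(G)$ denotes the spectral radius of $G$, i.e. the largest eigenvalue of its adjacency matrix. A graph $G$ is co-connected if its complement $\overline{G}$ is connected. A graph is $K_{r+1}$-free if it does not contain the complete graph $K_{r+1}$ as a subgraph. For positive integers $n_1\geq n_2\geq\cdots\geq n_r$ with $n_1+\cdots+n_r=n$, $K_{n_1,\ldots,n_r}$ denotes the complete $r$-partite graph with vertex classes $V_1,\ldots,V_r$, where $|V_i|=n_i$. The Turán graph $T_r(n)$ is the complete $r$-partite graph $K_{n_1,\ldots,n_r}$ with $n_1-n_r\leq 1$. $T_r^-(n)$ denotes the graph obtained from $T_r(n)$ by deleting the edges of a star $S_r$ on $r$ vertices whose center lies in $V_1$ (a largest vertex class) and whose $r-1$ leaves lie one in each of the classes $V_2,\ldots,V_r$. *)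

(* Defs.v *)
From HB Require Import structures.
From mathcomp Require Import all_boot all_order all_algebra.
From mathcomp Require Import classical_sets reals.

Set Implicit Arguments.
Unset Strict Implicit.
Unset Printing Implicit Defensive.

Import Order.TTheory GRing.Theory Num.Theory.

Record sgraph := SGraph {
  vertex :> finType;
  adj : rel vertex;
  adj_sym : symmetric adj;
  adj_irrefl : irreflexive adj }.

Definition isomorphic (G H : sgraph) : Prop :=
  exists2 f : G -> H, bijective f & forall x y, adj (f x) (f y) = adj x y.

(* H is a subgraph of G, not necessarily induced and up to isomorphism. *)
Definition has_subgraph (H G : sgraph) : Prop :=
  exists2 f : H -> G, injective f & forall x y, adj x y -> adj (f x) (f y).

Section Complement.
Variable G : sgraph.
Definition compl_adj : rel G := fun x y => (x != y) && ~~ adj x y.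
Lemma compl_adj_sym : symmetric compl_adj.
Proof. by move=> x y; rewrite /compl_adj eq_sym adj_sym. Qed.
Lemma compl_adj_irrefl : irreflexive compl_adj.
Proof. by move=> x; rewrite /compl_adj eqxx. Qed.
Definition compl_graph := SGraph compl_adj_sym compl_adj_irrefl.
End Complement.

Definition connected_graph (G : sgraph) : Prop :=
  0 < #|G| /\ forall x y : G, connect (@adj G) x y.

Definition co_connected (G : sgraph) : Prop := connected_graph (compl_graph G).

Section Complete.
Variable k : nat.
Definition complete_adj : rel 'I_k := fun x y => x != y.
Lemma complete_adj_sym : symmetric complete_adj.
Proof. by move=> x y; rewrite /complete_adj eq_sym. Qed.
Lemma complete_adj_irrefl : irreflexive complete_adj.
Proof. by move=> x; rewrite /complete_adj eqxx. Qed.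
Definition complete_graph := SGraph complete_adj_sym complete_adj_irrefl.
End Complete.

Definition clique_free (k : nat) (G : sgraph) : Prop :=
  ~ has_subgraph (complete_graph k) G.

(* The class V_(i+1) of K_{s 0, ..., s (r-1)} is the set of pairs tagged by i. *)
Section Multipartite.
Variables (r : nat) (s : 'I_r -> nat).
Definition multipartite_vertex : finType := {i : 'I_r & 'I_(s i)}.
Definition multipartite_adj : rel multipartite_vertex :=
  fun x y => tag x != tag y.
Lemma multipartite_adj_sym : symmetric multipartite_adj.
Proof. by move=> x y; rewrite /multipartite_adj eq_sym. Qed.
Lemma multipartite_adj_irrefl : irreflexive multipartite_adj.
Proof. by move=> x; rewrite /multipartite_adj eqxx. Qed.
Definition complete_multipartite :=
  SGraph multipartite_adj_sym multipartite_adj_irrefl.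
End Multipartite.

Definition turan_size (r n : nat) (i : 'I_r) : nat := n %/ r + (i < n %% r).

Lemma turan_size_noninc (r n : nat) (i j : 'I_r) :
  i <= j -> turan_size n j <= turan_size n i.
Proof.
move=> ij; rewrite leq_add2l; case: ltnP => // jn.
by rewrite (leq_ltn_trans ij jn).
Qed.

Lemma turan_size_balanced (r n : nat) (i j : 'I_r) :
  turan_size n i - turan_size n j <= 1.
Proof. by rewrite subnDl (leq_trans (leq_subr _ _)) ?leq_b1. Qed.

Lemma turan_size_sum (r n : nat) : 0 < r -> \sum_(i < r) turan_size n i = n.
Proof.
move=> r0; rewrite big_split sum_nat_const card_ord /=.
rewrite [in RHS](divn_eq n r) mulnC; congr (_ + _).
rewrite -(big_mkord xpredT (fun i => (i < n %% r) : nat)).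
rewrite (big_cat_nat (n := n %% r)) //=; last by rewrite ltnW ?ltn_mod.
rewrite [X in _ + X]big_nat_cond [X in _ + X]big1 ?addn0; last first.
  by move=> i /andP[/andP[ni _] _]; rewrite ltnNge ni.
rewrite big_nat_cond (eq_bigr (fun=> 1)); last by move=> i /andP[/andP[_ ->]].
by rewrite -big_nat_cond sum_nat_const_nat subn0 muln1.
Qed.

Definition turan_graph (r n : nat) : sgraph :=
  complete_multipartite (@turan_size r n).

Section TuranMinus.
Variables r n : nat.

(* The deleted star: its vertices are the elements of index 0 of the classes,
   and its center is the one in the first class, which is a largest one. *)
Definition star_center (x : turan_graph r n) : bool :=
  (tag x == 0 :> nat) && (tagged x == 0 :> nat).
Definition star_leaf (x : turan_graph r n) : bool :=
  (tag x != 0 :> nat) && (tagged x == 0 :> nat).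

Definition star_adj : rel (turan_graph r n) := fun x y =>
  star_center x && star_leaf y || star_center y && star_leaf x.

Definition turan_minus_adj : rel (turan_graph r n) :=
  fun x y => adj x y && ~~ star_adj x y.

Lemma turan_minus_adj_sym : symmetric turan_minus_adj.
Proof.
by move=> x y; rewrite /turan_minus_adj adj_sym /star_adj orbC.
Qed.
Lemma turan_minus_adj_irrefl : irreflexive turan_minus_adj.
Proof. by move=> x; rewrite /turan_minus_adj adj_irrefl. Qed.

Definition turan_minus := SGraph turan_minus_adj_sym turan_minus_adj_irrefl.
End TuranMinus.

Local Open Scope ring_scope.

Definition adjmx (R : realType) (G : sgraph) : 'M[R]_#|G| :=
  \matrix_(i, j) (adj (enum_val i) (enum_val j))%:R.

(* The set of eigenvalues is finite, and nonempty when G has a vertex (the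
   matrix is real symmetric), so that this supremum is the largest eigenvalue. *)
Definition spectral_radius (R : realType) (G : sgraph) : R :=
  sup [set x : R | eigenvalue (adjmx R G) x]%classic.

(* Main.v *)
(* Let l be the spectral radius of G, and suppose l is at least that of T_r^-(n).

   Erdos' degree majorisation, weighted by the Perron vector x of G, gives an
   r-partition for which the deficit (1 - 1/r) n^2 - l n = O(r) bounds at once
   the weight of the edges inside the classes, that of the missing edges between
   them, the spread of the class sums and the spread of x.  Since n >= 65 r^2,
   every entry of x is then comparable to its mean and every class keeps a vertex
   joined to all the other classes, so that an edge inside a class would complete
   a K_{r+1}: G is r-partite with all classes nonempty.

   Choose G of maximal spectral radius on its vertex set.  If t_i minimises x on
   the i-th class and t_c is the least of these minima, then replacing the missing
   edges, which connect the classes, by the star t_c t_i does not decrease the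
   quadratic form of x; hence G is complete multipartite minus such a star.

   Normalise x to have sum 1, let k_i be the class sizes, k'_i those of T_r(n) with
   V_1 indexed by c', and put q = x(t_c) / l, Q = (sum of x(t_i), i <> c) / l.  The
   vector built on T_r^-(n) from the same l, q, Q by the formulas for x has
   Rayleigh surplus l (u (1 + q) + v (1 + Q)) + l^2 (u + v)^2 - 2 u v with
   u = (1 + q) (sum_{i <> c} 1/(l + k_i) - sum_{i <> c'} 1/(l + k'_i)) and
   v = (1 + Q) (1/(l + k_c) - 1/(l + k'_{c'})).  As q <= Q, convexity of
   1/(l + k) makes u (1 + q) + v (1 + Q) nonnegative, so u = v = 0, the class
   sizes agree, and G is T_r^-(n). *)
Require Import Defs.
From mathcomp Require Import all_boot all_order all_algebra.
From mathcomp Require Import classical_sets reals.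
From mathcomp Require Import boolp topology normedtype derive.
From mathcomp Require Import fintype finset.
From mathcomp Require Import ring lra.

Set Implicit Arguments.
Unset Strict Implicit.
Unset Printing Implicit Defensive.

Import Order.TTheory GRing.Theory Num.Theory.
Import numFieldNormedType.Exports.

(** * Rayleigh quotients *)

Section QuadraticForm.
Local Open Scope ring_scope.
Variable R : realType.

(** The sphere is closed and lies in the cube [-1, 1]^(m+1), hence compact, and the form is
    continuous. *)
Lemma sphere_max (m : nat) (a : 'M[R]_m.+1) :
  exists2 x : 'rV[R]_m.+1, \sum_i x ord0 i ^+ 2 = 1 &
    forall y : 'rV[R]_m.+1, \sum_i y ord0 i ^+ 2 = 1 ->
      \sum_i \sum_j a i j * y ord0 i * y ord0 j <=
      \sum_i \sum_j a i j * x ord0 i * x ord0 j.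
Proof.
pose sph : set 'rV[R]_m.+1 := [set x | \sum_i x ord0 i ^+ 2 = 1]%classic.
have sq_cont : continuous (fun x : 'rV[R]_m.+1 => \sum_i x ord0 i ^+ 2).
  apply: continuous_big => [|i _]; first exact: add_continuous.
  move=> x; have := @continuousM _ _ _ _ x
    (@coord_continuous R 1 m.+1 ord0 i x) (@coord_continuous R 1 m.+1 ord0 i x).
  exact.
have form_cont : continuous (fun x : 'rV[R]_m.+1 =>
    \sum_i \sum_j a i j * x ord0 i * x ord0 j).
  apply: continuous_big => [|i _]; first exact: add_continuous.
  apply: continuous_big => [|j _]; first exact: add_continuous.
  move=> x.
  have cst_cont : continuous (fun _ : 'rV[R]_m.+1 => a i j).
    by move=> z; apply: cst_continuous.
  have := continuousM
    (continuousM (cst_cont x) (@coord_continuous R 1 m.+1 ord0 i x))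
    (@coord_continuous R 1 m.+1 ord0 j x).
  exact.
have sph_closed : closed sph.
  rewrite (_ : sph =
    ((fun x : 'rV[R]_m.+1 => \sum_i x ord0 i ^+ 2) @^-1` [set 1])%classic) //.
  by apply: preimage_closed => [x _|]; [exact: sq_cont | exact: closed_eq].
have sph_compact : compact sph.
  apply: (subclosed_compact sph_closed
    (@rV_compact _ _ (fun=> `[(-1 : R), 1]%classic) _)) => [i|x x1 i] /=.
    exact: segment_compact.
  rewrite in_itv /= -ler_norml -(@ler_pXn2r _ 2) ?nnegrE//.
  rewrite expr1n real_normK ?num_real//.
  by rewrite -[leRHS]x1 (bigD1 i) //= lerDl sumr_ge0 // => j _; rewrite sqr_ge0.
have sph_neq0 : (sph !=set0)%classic.
  exists (delta_mx ord0 ord0); rewrite /sph /= (bigD1 ord0) //=.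
  rewrite big1 => [|i /negPf i0].
    by rewrite mxE eqxx addr0 expr1n.
  by rewrite mxE i0 andbF expr0n.
have [x xs xmax] := EVT_max_rV sph_neq0 sph_compact
  (continuous_subspaceT form_cont).
exists x => [|y y1]; first exact: set_mem xs.
by apply: xmax; exact: mem_set.
Qed.

End QuadraticForm.

(** * The spectral radius as the maximum of a quadratic form *)

Section Spectral.
Local Open Scope ring_scope.
Variable R : realType.

(** This is x^T A x, with every edge counted twice. Keeping the relation free lets one vector be
    tested on several graphs. *)
Definition qform (V : finType) (e : rel V) (x : V -> R) : R :=
  \sum_u \sum_v (e u v)%:R * x u * x v.

Definition sqnorm (V : finType) (x : V -> R) : R := \sum_v x v ^+ 2.

Lemma sqnorm_ge0 (V : finType) (x : V -> R) : 0 <= sqnorm x.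
Proof. by apply: sumr_ge0 => v _; rewrite sqr_ge0. Qed.

Lemma sqnorm_eq0 (V : finType) (x : V -> R) : sqnorm x = 0 -> forall v, x v = 0.
Proof.
move=> /eqP; rewrite psumr_eq0 => [/allP x0 v|v _]; last exact: sqr_ge0.
by apply/eqP; rewrite -sqrf_eq0; apply: (implyP (x0 v _)); rewrite ?mem_index_enum.
Qed.

Lemma qformZ (V : finType) (e : rel V) (c : R) (x : V -> R) :
  qform e (fun v => c * x v) = c ^+ 2 * qform e x.
Proof.
rewrite /qform mulr_sumr; apply: eq_bigr => u _.
by rewrite mulr_sumr; apply: eq_bigr => v _; ring.
Qed.

Lemma sqnormZ (V : finType) (c : R) (x : V -> R) :
  sqnorm (fun v => c * x v) = c ^+ 2 * sqnorm x.
Proof. by rewrite /sqnorm mulr_sumr; apply: eq_bigr => v _; rewrite exprMn. Qed.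

Lemma qformE (V : finType) (e : rel V) (x : V -> R) :
  qform e x = \sum_u x u * \sum_v (e u v)%:R * x v.
Proof.
by apply: eq_bigr => u _; rewrite mulr_sumr; apply: eq_bigr => v _; ring.
Qed.

Lemma qform_eigen (V : finType) (e : rel V) (l : R) (x : V -> R) :
  (forall u, \sum_v (e u v)%:R * x v = l * x u) -> qform e x = l * sqnorm x.
Proof.
move=> ex; rewrite qformE /sqnorm mulr_sumr.
by apply: eq_bigr => u _; rewrite ex; ring.
Qed.

Lemma ler_qform_norm (V : finType) (e : rel V) (x : V -> R) :
  qform e x <= qform e (fun v => `|x v|).
Proof.
apply: ler_sum => u _; apply: ler_sum => v _.
rewrite -!mulrA -normrM; apply: ler_wpM2l; first exact: ler0n.
exact: ler_norm.
Qed.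

Lemma sqnorm_norm (V : finType) (x : V -> R) :
  sqnorm (fun v => `|x v|) = sqnorm x.
Proof. by apply: eq_bigr => v _; rewrite real_normK ?num_real. Qed.

Lemma qform_max (V : finType) (e : rel V) : (0 < #|V|)%N ->
  exists2 x : V -> R, sqnorm x = 1 &
    forall y, sqnorm y = 1 -> qform e y <= qform e x.
Proof.
move=> V_gt0.
have [m Vm] : exists m, #|V| = m.+1 by exists #|V|.-1; rewrite prednK.
pose h (v : V) : 'I_m.+1 := cast_ord Vm (enum_rank v).
pose g (i : 'I_m.+1) : V := enum_val (cast_ord (esym Vm) i).
have hK : cancel h g by move=> v; rewrite /g /h cast_ordK enum_rankK.
have gK : cancel g h by move=> i; rewrite /g /h enum_valK cast_ordKV.
have g_bij : {on [pred _ | true], bijective g} by exists h => ? _; rewrite ?hK ?gK.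
have [x x1 xmax] := sphere_max (\matrix_(i, j) (e (g i) (g j))%:R : 'M[R]_m.+1).
have formE (y : 'rV[R]_m.+1) :
  \sum_i \sum_j (\matrix_(i, j) (e (g i) (g j))%:R : 'M[R]_m.+1) i j
    * y ord0 i * y ord0 j = qform e (fun v => y ord0 (h v)).
  rewrite /qform (reindex g) //=; apply: eq_bigr => i _.
  rewrite (reindex g) //=; apply: eq_bigr => j _.
  by rewrite mxE !gK.
have sqE (y : 'rV[R]_m.+1) : \sum_i y ord0 i ^+ 2 = sqnorm (fun v => y ord0 (h v)).
  by rewrite /sqnorm (reindex g) //=; apply: eq_bigr => i _; rewrite gK.
exists (fun v => x ord0 (h v)); first by rewrite -sqE.
move=> y y1; have := xmax (\row_i y (g i)); rewrite sqE !formE.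
have -> : (fun v => (\row_i y (g i)) ord0 (h v)) = y.
  by apply/funext => v; rewrite mxE hK.
exact.
Qed.

(** Symmetry makes the two cross terms equal and irreflexivity kills the term in t^2. *)
Lemma qform_bump (V : finType) (e : rel V) (x : V -> R) (w : V) (t : R) :
  symmetric e -> irreflexive e ->
  qform e (fun v => x v + t * (v == w)%:R) =
    qform e x + 2 * t * \sum_v (e w v)%:R * x v.
Proof.
move=> e_sym e_irr.
transitivity (qform e x + t * (\sum_u \sum_v (e u v)%:R * (u == w)%:R * x v)
  + t * (\sum_u \sum_v (e u v)%:R * x u * (v == w)%:R)
  + t ^+ 2 * (\sum_u \sum_v (e u v)%:R * (u == w)%:R * (v == w)%:R)).
  rewrite /qform !mulr_sumr -!big_split /=; apply: eq_bigr => u _.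
  rewrite !mulr_sumr -!big_split /=; apply: eq_bigr => v _; ring.
have -> : \sum_u \sum_v (e u v)%:R * (u == w)%:R * x v = \sum_v (e w v)%:R * x v.
  rewrite (bigD1 w) //= [X in _ + X]big1 ?addr0 => [|u /negPf ->].
    by apply: eq_bigr => v _; rewrite eqxx mulr1.
  by rewrite big1 // => v _; rewrite mulr0 mul0r.
have -> : \sum_u \sum_v (e u v)%:R * x u * (v == w)%:R = \sum_v (e w v)%:R * x v.
  apply: eq_bigr => u _; rewrite (bigD1 w) //= big1 => [|v /negPf ->].
    by rewrite eqxx mulr1 addr0 e_sym.
  by rewrite mulr0.
rewrite [X in _ ^+ 2 * X]big1 => [|u _]; first by ring.
rewrite big1 // => v _.
case: (u =P w) => [->|_]; last by rewrite mulr0 mul0r.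
by case: (v =P w) => [->|_]; rewrite ?mulr0 // e_irr !mul0r.
Qed.

Lemma sqnorm_bump (V : finType) (x : V -> R) (w : V) (t : R) :
  sqnorm (fun v => x v + t * (v == w)%:R) = sqnorm x + 2 * t * x w + t ^+ 2.
Proof.
rewrite /sqnorm (bigD1 w) //= [in RHS](bigD1 w) //= eqxx mulr1.
rewrite (eq_bigr (fun v => x v ^+ 2)) => [|v /negPf ->]; first by ring.
by rewrite mulr0 addr0.
Qed.

(** First-order condition at a maximiser of the Rayleigh quotient, tested by moving the single entry
    at [u]. *)
Lemma maximizer_eigen (V : finType) (e : rel V) (l : R) (x : V -> R) :
  symmetric e -> irreflexive e ->
  (forall y, qform e y <= l * sqnorm y) -> qform e x = l * sqnorm x ->
  forall u, \sum_v (e u v)%:R * x v = l * x u.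
Proof.
move=> e_sym e_irr lmax xl u.
have l_ge0 : 0 <= l.
  have := lmax (fun v => 0 + 1 * (v == u)%:R).
  rewrite qform_bump // sqnorm_bump.
  have -> : qform e (fun=> 0) = 0.
    by rewrite /qform big1 // => v _; rewrite big1 // => w _; rewrite mulr0.
  have -> : sqnorm (fun _ : V => 0 : R) = 0 :> R.
    by rewrite /sqnorm big1 // => v _; rewrite expr0n.
  have -> : \sum_v (e u v)%:R * (0 : R) = 0.
    by rewrite big1 // => v _; rewrite mulr0.
  by lra.
set s := \sum_v _; pose d := l * x u - s.
(* With D = d / (l + 1), maximality becomes D^2 (l + 2) <= 0. The denominator stays positive even
   when l = 0. *)
have := lmax (fun v => x v + (- d / (l + 1)) * (v == u)%:R).
rewrite qform_bump // sqnorm_bump xl -/s.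
have l1 : l + 1 != 0 by rewrite gt_eqF //; lra.
have : forall D, D * (l + 1) = d ->
  l * sqnorm x + 2 * (- D) * s <=
  l * (sqnorm x + 2 * (- D) * x u + (- D) ^+ 2) -> s = l * x u.
  move=> D Dd H; have HD : 2 * D * d <= l * D ^+ 2 by rewrite /d; lra.
  have : D ^+ 2 * (l + 2) <= 0 by rewrite -Dd in HD; nra.
  rewrite pmulr_lle0; last by lra.
  rewrite le_eqVlt ltNge sqr_ge0 orbF sqrf_eq0 => /eqP D0.
  by move: Dd; rewrite D0 mul0r /d; lra.
move=> /(_ (d / (l + 1))); rewrite mulNr; apply.
by rewrite divfK.
Qed.

(** Replacing a maximiser by its absolute value does not lower the form, which gives a nonnegative
    eigenvector. Each eigenvalue is a Rayleigh quotient, so the maximum of the form is the largest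
    one. *)
Lemma spectral_radiusP (G : sgraph) : (0 < #|G|)%N ->
  exists x : G -> R, [/\ forall v, 0 <= x v, sqnorm x = 1,
    forall u, \sum_v (adj u v)%:R * x v = spectral_radius R G * x u &
    forall y, qform (@adj G) y <= spectral_radius R G * sqnorm y].
Proof.
move=> G_gt0; have [x0 x01 x0max] := @qform_max G (@adj G) G_gt0.
pose x v := `|x0 v|; pose l := qform (@adj G) x.
have x1 : sqnorm x = 1 by rewrite sqnorm_norm.
have lmax y : qform (@adj G) y <= l * sqnorm y.
  have [y0|y0] := eqVneq (sqnorm y) 0.
    rewrite y0 mulr0 /qform big1 // => u _; rewrite big1 // => v _.
    by rewrite (sqnorm_eq0 y0) mulr0 mul0r.
  have y_gt0 : 0 < sqnorm y by rewrite lt_def y0 sqnorm_ge0.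
  have sq0 : Num.sqrt (sqnorm y) != 0 by rewrite gt_eqF // sqrtr_gt0.
  pose z v := (Num.sqrt (sqnorm y))^-1 * y v.
  have z1 : sqnorm z = 1.
    by rewrite sqnormZ exprVn sqr_sqrtr ?ltW // mulVf.
  have yE : y = fun v => Num.sqrt (sqnorm y) * z v.
    by apply/funext => v; rewrite /z mulrA mulfV // mul1r.
  have -> : qform (@adj G) y = qform (@adj G) z * sqnorm y.
    by rewrite [in LHS]yE qformZ sqr_sqrtr ?ltW // mulrC.
  rewrite ler_pM2r //.
  exact: le_trans (x0max _ z1) (ler_qform_norm _ _).
have xeig u : \sum_v (adj u v)%:R * x v = l * x u.
  apply: (maximizer_eigen (@adj_sym G) (@adj_irrefl G) lmax).
  by rewrite x1 mulr1.
suff -> : spectral_radius R G = l by exists x; split=> // v; exact: normr_ge0.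
have ub : ubound [set a : R | eigenvalue (adjmx R G) a]%classic l.
  move=> a /eigenvalueP[v va v0].
  pose y (w : G) := v ord0 (enum_rank w).
  have yeig u : \sum_w (adj u w)%:R * y w = a * y u.
    have := congr1 (fun M : 'rV_ _ => M ord0 (enum_rank u)) va.
    rewrite !mxE => <-.
    rewrite (reindex (@enum_rank G)) /=; last exact: onW_bij (@enum_rank_bij G).
    by apply: eq_bigr => w _; rewrite mxE !enum_rankK mulrC adj_sym.
  have := lmax y; rewrite (qform_eigen yeig) ler_pM2r //.
  rewrite lt_def sqnorm_ge0 andbT; apply: contra v0 => /eqP/sqnorm_eq0 y0.
  apply/eqP/rowP => i; rewrite mxE -(y0 (enum_val i)) /y enum_valK.
  by congr (v _ _); exact: ord1.
have lE : [set a : R | eigenvalue (adjmx R G) a]%classic l.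
  apply/eigenvalueP; exists (\row_i x (enum_val i)).
    apply/rowP => i; rewrite !mxE -xeig.
    rewrite (reindex (@enum_rank G)) /=; last exact: onW_bij (@enum_rank_bij G).
    by apply: eq_bigr => w _; rewrite !mxE enum_rankK mulrC adj_sym.
  apply/negP => /eqP/rowP x_eq0; move: x1; rewrite /sqnorm big1 => [|v _].
    by move/eqP; rewrite eq_sym oner_eq0.
  by have := x_eq0 (enum_rank v); rewrite !mxE enum_rankK => ->; rewrite expr0n.
apply/eqP; rewrite eq_le; apply/andP; split; first exact: ge_sup (ex_intro _ l lE) ub.
by apply: ub_le_sup => //; exists l.
Qed.

End Spectral.

(** * Weighted degree majorisation *)

Section WeightedTuran.
Local Open Scope ring_scope.
Variable R : realType.

Definition clique (V : finType) (e : rel V) (K : {set V}) :=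
  {in K &, forall u v, u != v -> e u v}.

(* Erdos' degree majorisation, in Furedi's form: the gain on the right over the
   total weight of the edges pays once more for the edges inside the classes. *)
Lemma weighted_turan (V : finType) (e : rel V) (w : V -> R) (r : nat)
    (U : {set V}) :
  symmetric e -> irreflexive e -> (forall v, 0 <= w v) ->
  (forall K : {set V}, K \subset U -> clique e K -> (#|K| <= r)%N) ->
  exists2 col : V -> nat, {in U, forall v, (col v < r)%N} &
    \sum_(u in U) \sum_(v in U)
      (e u v)%:R * (1 + (col u == col v)%:R) * (w u * w v) <=
    \sum_(u in U) \sum_(v in U) (col u != col v)%:R * (w u * w v).
Proof.
move=> e_sym e_irr w_ge0; elim: r U => [|r IHr] U U_cl.
  have U0 v : v \notin U.
    apply/negP => vU; suff : (#|[set v]| <= 0)%N by rewrite cards1.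
    apply: U_cl; first by rewrite sub1set.
    by move=> x y /set1P -> /set1P ->; rewrite eqxx.
  exists (fun=> 0%N) => [v vU|]; first by have := U0 v; rewrite vU.
  by rewrite !big_pred0 // => v; exact: negbTE.
have [->|[v0 v0U]] := set_0Vmem U.
  by exists (fun=> 0%N) => [v|]; rewrite ?inE // !big_set0.
pose d u := \sum_(v in U) (e u v)%:R * w v.
(* Take [x] of largest weighted degree: its neighbourhood N has smaller cliques and is coloured by
   induction, and the rest of U becomes the new class [r]. *)
have [x xU xmax] : exists2 x, x \in U & {in U, forall u, d u <= d x}.
  by have [x xU xmax] := arg_maxP d v0U; exists x => // u; exact: xmax.
pose N := [set v in U | e x v].
have NU : N \subset U by apply/fintype.subsetP => v; rewrite inE => /andP[].
have [|col' col'r IH] := IHr N.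
  move=> K KN Kcl.
  have xK : x \notin K.
    by apply/negP => /(fintype.subsetP KN); rewrite inE e_irr andbF.
  have := U_cl (x |: K); rewrite cardsU1 xK add1n ltnS; apply.
    by rewrite subUset sub1set xU (subset_trans KN NU).
  move=> u v /setU1P[->|uK] /setU1P[->|vK] uv; rewrite ?eqxx // in uv *.
  - by move/(fintype.subsetP KN): vK; rewrite inE => /andP[].
  - by move/(fintype.subsetP KN): uK; rewrite inE e_sym => /andP[].
  - exact: Kcl.
pose col v := if v \in N then col' v else r.
exists col => [v vU|].
  by rewrite /col; case: ifP => // /col'r; exact: ltnW.
have colN v : v \in N -> col v = col' v by rewrite /col => ->.
have colr v : v \notin N -> col v = r by rewrite /col => /negPf ->.
have col_neq u v : u \in N -> v \notin N -> col u != col v.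
  by move=> uN vN; rewrite colN // (colr v) // neq_ltn col'r.
pose F u v := (col u != col v)%:R * (w u * w v) -
  (e u v)%:R * (1 + (col u == col v)%:R) * (w u * w v).
have F_sym u v : F u v = F v u.
  by rewrite /F e_sym [col v == _]eq_sym [w v * _]mulrC.
have splitU (f : V -> R) :
    \sum_(v in U) f v = \sum_(v in N) f v + \sum_(v in U :\: N) f v.
  rewrite (big_setID N) /=; congr (_ + _).
  by apply: eq_bigl => v; rewrite (setIidPr NU).
suff F_ge0 : 0 <= \sum_(u in U) \sum_(v in U) F u v.
  rewrite -subr_ge0 -sumrB; congr (0 <= _): F_ge0; apply: eq_bigr => u _.
  by rewrite -sumrB.
(* For u outside N, both orientations of its pairs with N give 2 w(u) times the weight of its
   non-neighbours in N. Pairs inside U \ N charge each edge twice, which completes the degree of u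
   to d(u). *)
have -> : \sum_(u in U) \sum_(v in U) F u v =
  \sum_(u in N) \sum_(v in N) F u v +
  2 * \sum_(u in U :\: N) w u * (\sum_(v in N) w v - d u).
  rewrite splitU; under eq_bigr do rewrite splitU.
  under [X in _ + X]eq_bigr do rewrite splitU.
  rewrite !big_split /= [X in _ + X + _]exchange_big /= -!addrA; congr (_ + _).
  rewrite addrA -big_split -big_split /= mulr_sumr.
  apply: eq_bigr => u /setDP[uU uN]; rewrite /d splitU.
  under [X in X + _ + _]eq_bigr do rewrite F_sym.
  have -> : \sum_(v in N) F u v = \sum_(v in N) w u * w v * (1 - (e u v)%:R).
    apply: eq_bigr => v vN; rewrite /F eq_sym (negPf (col_neq v u vN uN)) /=.
    by rewrite addr0; ring.
  have -> : \sum_(v in U :\: N) F u v =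
      - 2 * w u * \sum_(v in U :\: N) (e u v)%:R * w v.
    rewrite mulr_sumr; apply: eq_bigr => v /setDP[_ vN].
    by rewrite /F !colr // eqxx /=; ring.
  have -> : \sum_(v in N) w u * w v * (1 - (e u v)%:R) =
     w u * (\sum_(v in N) w v - \sum_(v in N) (e u v)%:R * w v).
    by rewrite -sumrB mulr_sumr; apply: eq_bigr => v _; ring.
  by ring.
apply: addr_ge0.
  rewrite -subr_ge0 -sumrB in IH; congr (0 <= _): IH.
  apply: eq_bigr => u uN; rewrite -sumrB.
  by apply: eq_bigr => v vN; rewrite /F !colN.
rewrite mulr_ge0 // sumr_ge0 // => u /setDP[uU _].
rewrite mulr_ge0 // subr_ge0 (le_trans (xmax _ uU)) //.
(* All neighbours of [x] in U lie in N, so d(x) is the weight of N. *)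
rewrite /d splitU [X in _ + X]big1 => [|v /setDP[vU]].
  by rewrite addr0; apply: ler_sum => v _; case: (e x v); rewrite ?mul1r ?mul0r.
by rewrite inE vU /= => /negPf ->; rewrite mul0r.
Qed.

End WeightedTuran.

(** * Complete multipartite graphs minus a star *)

Section StarMinus.
Local Open Scope ring_scope.
Variables (R : realType) (r : nat).

(** The map [t] is meant to choose a root in each class: the star has centre [t c] and leaves [t i]
    for i <> c. The disjuncts are the two orientations of an edge. *)
Definition star_rel (V : finType) (col : V -> 'I_r) (t : 'I_r -> V) (c : 'I_r)
    : rel V := fun u v =>
  [&& u == t c, v == t (col v) & col v != c] ||
  [&& v == t c, u == t (col u) & col u != c].

Definition star_minus_rel (V : finType) (col : V -> 'I_r) (t : 'I_r -> V)
    (c : 'I_r) : rel V :=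
  fun u v => (col u != col v) && ~~ star_rel col t c u v.

Definition class_size (V : finType) (col : V -> 'I_r) (i : 'I_r) : nat :=
  #|[pred v | col v == i]|.

Definition class_sum (V : finType) (col : V -> 'I_r) (x : V -> R) (i : 'I_r)
    : R :=
  \sum_(v | col v == i) x v.

Lemma sum_class_sum (V : finType) (col : V -> 'I_r) (x : V -> R) :
  \sum_i class_sum col x i = \sum_v x v.
Proof. by rewrite [RHS](partition_big col xpredT). Qed.

Lemma sum_mul_class (V : finType) (col : V -> 'I_r) (x : V -> R)
    (f : 'I_r -> R) :
  \sum_v x v * f (col v) = \sum_i class_sum col x i * f i.
Proof.
rewrite (partition_big col xpredT) //=; apply: eq_bigr => i _.
by rewrite mulr_suml; apply: eq_bigr => v /eqP ->.
Qed.

Lemma sum_class_size (V : finType) (col : V -> 'I_r) :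
  (\sum_i class_size col i)%N = #|V|.
Proof.
rewrite -sum1_card (partition_big col xpredT) //=.
by apply: eq_bigr => i _; rewrite /class_size -sum1_card.
Qed.

Lemma sum_class_const (V : finType) (col : V -> 'I_r) (i : 'I_r) (a : R) :
  \sum_(v | col v == i) a = (class_size col i)%:R * a.
Proof. by rewrite sumr_const mulr_natl. Qed.

Section Fixed.
Variables (V : finType) (col : V -> 'I_r) (t : 'I_r -> V) (c : 'I_r).

Lemma star_minus_sym : symmetric (star_minus_rel col t c).
Proof. by move=> u v; rewrite /star_minus_rel eq_sym /star_rel orbC. Qed.

Lemma star_minus_irrefl : irreflexive (star_minus_rel col t c).
Proof. by move=> u; rewrite /star_minus_rel eqxx. Qed.

Hypothesis tK : cancel t col.

Lemma star_rel_col u v : star_rel col t c u v -> col u != col v.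
Proof.
by case/orP => /and3P[/eqP -> _ vc]; rewrite tK // eq_sym.
Qed.

Lemma sum_transversal (f : V -> R) (P : pred 'I_r) :
  \sum_(v | (v == t (col v)) && P (col v)) f v = \sum_(i | P i) f (t i).
Proof.
rewrite (reindex_onto t col) => [|v /andP[/eqP <-] //].
by apply: eq_bigl => i; rewrite !tK !eqxx andbT.
Qed.

Lemma sum_transversalR (f : V -> R) :
  \sum_v (v == t (col v))%:R * f v = \sum_i f (t i).
Proof.
rewrite -(sum_transversal _ xpredT) [RHS]big_mkcond.
by apply: eq_bigr => v _; rewrite andbT; case: ifP; rewrite ?mul1r ?mul0r.
Qed.

Lemma star_rel_sum (x : V -> R) (u : V) :
  \sum_v (star_rel col t c u v)%:R * x v = (u == t (col u))%:R *
    (if col u == c then \sum_(i | i != c) x (t i) else x (t c)).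
Proof.
have [uc|uc] := eqVneq (col u) c; last first.
  have [ut|ut] := eqVneq u (t (col u)); last first.
    rewrite mul0r big1 // => v _; rewrite /star_rel (negPf ut) andbF orbF.
    case: eqP => [uE|_]; last by rewrite mul0r.
    by case/eqP: uc; rewrite uE tK.
  have utc : (u == t c) = false.
    by apply: contraNF uc => /eqP ->; rewrite tK.
  rewrite (bigD1 (t c)) //= big1 ?addr0 => [|v /negPf vc].
    by rewrite /star_rel utc eqxx -ut eqxx uc /= .
  by rewrite /star_rel utc vc mul0r.
have -> : \sum_v (star_rel col t c u v)%:R * x v =
    \sum_v (u == t c)%:R * ((v == t (col v)) && (col v != c))%:R * x v.
  by apply: eq_bigr => v _; rewrite /star_rel uc eqxx !andbF orbF -natrM mulnb.
rewrite uc -(sum_transversal _ (fun i => i != c)) mulr_sumr [RHS]big_mkcond /=.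
apply: eq_bigr => v _.
by case: ifP => _; rewrite ?mulr1 // mulr0 mul0r.
Qed.

Lemma star_minus_sum (x : V -> R) (u : V) :
  \sum_v (star_minus_rel col t c u v)%:R * x v =
  \sum_v x v - class_sum col x (col u) - (u == t (col u))%:R *
    (if col u == c then \sum_(i | i != c) x (t i) else x (t c)).
Proof.
rewrite -star_rel_sum /class_sum [X in _ = _ - X - _]big_mkcond -!sumrB /=.
apply: eq_bigr => v _; rewrite /star_minus_rel [col u == _]eq_sym.
have [uv|uv] := eqVneq (col v) (col u); last first.
  by case: (star_rel _ _ _ _ _) => /=; ring.
have -> : star_rel col t c u v = false; last by rewrite /=; ring.
by apply: contraTF (introT eqP uv) => /star_rel_col; rewrite eq_sym.
Qed.

Lemma star_minus_qform (x : V -> R) :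
  qform (star_minus_rel col t c) x =
  (\sum_v x v) ^+ 2 - \sum_i class_sum col x i ^+ 2 -
  2 * x (t c) * \sum_(i | i != c) x (t i).
Proof.
rewrite qformE; under eq_bigr do rewrite star_minus_sum.
set S := \sum_v x v; set P := \sum_(i | i != c) x (t i).
transitivity (\sum_v x v * (S - class_sum col x (col v)) -
  \sum_v (v == t (col v))%:R * (x v * if col v == c then P else x (t c))).
  by rewrite -sumrB; apply: eq_bigr => v _; ring.
rewrite (sum_mul_class col x (fun i => S - class_sum col x i)).
have -> : \sum_i class_sum col x i * (S - class_sum col x i) =
    S ^+ 2 - \sum_i class_sum col x i ^+ 2.
  have -> : S ^+ 2 = \sum_i class_sum col x i * S.
    by rewrite -mulr_suml sum_class_sum.
  by rewrite -sumrB; apply: eq_bigr => i _; ring.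
congr (_ - _).
rewrite (sum_transversalR (fun v => x v * if col v == c then P else x (t c))).
rewrite (bigD1 c) //= tK eqxx (eq_bigr (fun i => x (t i) * x (t c))).
  by rewrite -mulr_suml -/P; ring.
by move=> i /negPf ic; rewrite tK ic.
Qed.

(** Here [q] is the sum of [x] over the star neighbours of [t i]. On class i the eigenvalue equation
    reads l x(v) = 1 - (class sum), less [q] at the root; summing over the class solves for the
    class sum. *)
Lemma star_eigen_class (l : R) (x : V -> R) : 0 < l -> \sum_v x v = 1 ->
  (forall u, \sum_v (star_minus_rel col t c u v)%:R * x v = l * x u) ->
  forall i, let q := if i == c then \sum_(j | j != c) x (t j) else x (t c) in
  let a := (l + (class_size col i)%:R)^-1 in
  l * x (t i) = (l + q) * a - q /\ class_sum col x i = 1 - (l + q) * a.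
Proof.
move=> l_gt0 x1 xeig i q a.
have xcol v : col v = i -> l * x v = 1 - class_sum col x i - (v == t i)%:R * q.
  by move=> vi; rewrite -xeig star_minus_sum x1 vi.
have a0 : l + (class_size col i)%:R != 0.
  by rewrite gt_eqF // ltr_wpDr // ler0n.
have clE : l * class_sum col x i =
    (class_size col i)%:R * (1 - class_sum col x i) - q.
  rewrite {1}/class_sum mulr_sumr.
  rewrite (eq_bigr (fun v => (1 - class_sum col x i) - (v == t i)%:R * q));
    last by move=> v /eqP/xcol.
  rewrite sumrB sum_class_const; congr (_ - _).
  rewrite (bigD1 (t i)) ?tK //= eqxx mul1r big1 ?addr0 //.
  by move=> v /andP[_ /negPf ->]; rewrite mul0r.
have sE : class_sum col x i = 1 - (l + q) * a.
  apply: (mulIf a0); rewrite mulrBl mul1r -mulrA mulVf // mulr1.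
  by rewrite mulrDr [X in X + _]mulrC clE; ring.
by split=> //; rewrite (xcol _ (tK i)) sE eqxx mul1r; ring.
Qed.

(** These are the entries found in [star_eigen_class], with star sums divided by [l]: [Q] serves the
    centre class and [q0] the others. Both may come from another graph, so this need not be an
    eigenvector. *)
Definition star_test (l q0 Q : R) (v : V) : R :=
  let q := if col v == c then Q else q0 in
  (1 + q) / (l + (class_size col (col v))%:R) - (v == t (col v))%:R * q.

Lemma star_test_class (l q0 Q : R) (i : 'I_r) : 0 < l ->
  class_sum col (star_test l q0 Q) i =
  1 - l * ((1 + if i == c then Q else q0) / (l + (class_size col i)%:R)).
Proof.
move=> l_gt0; set q := if _ then _ else _.
have a0 : l + (class_size col i)%:R != 0.
  by rewrite gt_eqF // ltr_wpDr // ler0n.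
rewrite /class_sum (eq_bigr (fun v =>
    (1 + q) / (l + (class_size col i)%:R) - (v == t i)%:R * q)); last first.
  by move=> v /eqP vi; rewrite /star_test vi.
rewrite sumrB sum_class_const.
rewrite [X in _ - X](bigD1 (t i)) ?tK //= eqxx mul1r big1 ?addr0.
  by field.
by move=> v /andP[_ /negPf ->]; rewrite mul0r.
Qed.

(** By construction l z(v) = 1 - (class sum), less a star term at the root; multiplying by z(v) and
    summing eliminates the squared class sums. *)
Lemma star_test_qform (l q0 Q : R) (z := star_test l q0 Q) : 0 < l ->
  qform (star_minus_rel col t c) z - l * sqnorm z =
  (\sum_v z v) ^+ 2 - \sum_v z v + l * q0 * \sum_(i | i != c) z (t i) +
  l * Q * z (t c) - 2 * z (t c) * \sum_(i | i != c) z (t i).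
Proof.
move=> l_gt0; rewrite star_minus_qform.
suff : \sum_i class_sum col z i ^+ 2 + l * sqnorm z = \sum_v z v -
    l * q0 * \sum_(i | i != c) z (t i) - l * Q * z (t c) by lra.
have -> : \sum_i class_sum col z i ^+ 2 = \sum_v z v * class_sum col z (col v).
  by rewrite sum_mul_class.
rewrite /sqnorm mulr_sumr -big_split /=.
transitivity (\sum_v z v - \sum_v (v == t (col v))%:R *
    (z v * l * if col v == c then Q else q0)).
  rewrite -sumrB; apply: eq_bigr => v _.
  have -> : class_sum col z (col v) = 1 - l * z v -
      l * ((v == t (col v))%:R * if col v == c then Q else q0).
    by rewrite star_test_class // /z /star_test; ring.
  by ring.
rewrite (sum_transversalR (fun v => z v * l * if col v == c then Q else q0)).
rewrite (bigD1 c) //= tK eqxx (eq_bigr (fun i => z (t i) * (l * q0))).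
  by rewrite -mulr_suml; ring.
by move=> i /negPf ic; rewrite tK ic; ring.
Qed.

End Fixed.
End StarMinus.

(** * Balanced class sizes *)

Section Balance.
Local Open Scope ring_scope.
Variables (R : realType) (l : R).
Hypothesis l_gt0 : 0 < l.

Definition inv_shift (k : nat) : R := (l + k%:R)^-1.

Lemma inv_shift_gt0 k : 0 < inv_shift k.
Proof. by rewrite invr_gt0 ltr_wpDr // ler0n. Qed.

Lemma inv_shift_neq0 (k : nat) : l + k%:R != 0.
Proof. by rewrite gt_eqF // ltr_wpDr // ler0n. Qed.

(* The gap between [k |-> 1 / (l + k)] and its secant through [q], [q + 1]. *)
Lemma secant_gap (q k : nat) :
  inv_shift k - inv_shift q + (k%:R - q%:R) * (inv_shift q * inv_shift q.+1) =
  (k%:R - q%:R) * (k%:R - q.+1%:R) *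
    (inv_shift k * inv_shift q * inv_shift q.+1).
Proof.
rewrite /inv_shift; have := inv_shift_neq0 k; have := inv_shift_neq0 q.
have := inv_shift_neq0 q.+1; rewrite -natr1 => h1 h2 h3.
by field; rewrite h3 h2 h1.
Qed.

(** No integer lies strictly between q and q + 1. *)
Lemma consecutive_prod_ge0 (q k : nat) :
  0 <= ((k%:R - q%:R) * (k%:R - q.+1%:R) : R).
Proof.
have [kq|qk] := leqP k q.
  have kq' : (k%:R <= q%:R :> R) by rewrite ler_nat.
  by rewrite mulr_le0 // subr_le0 // (le_trans kq') // ler_nat.
by rewrite mulr_ge0 // subr_ge0 ler_nat // ltnW.
Qed.

Lemma consecutive_prod_eq0 (q k : nat) :
  (k%:R - q%:R) * (k%:R - q.+1%:R) = 0 :> R -> k = q \/ k = q.+1.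
Proof.
move/eqP; rewrite mulf_eq0 !subr_eq0 !eqr_nat.
by case/orP => /eqP; [left | right].
Qed.

(** The linear part of the secant cancels because the totals agree, and the gap vanishes at sizes q
    and q + 1. *)
Lemma sum_secant_gap (r q : nat) (k k' : 'I_r -> nat) :
  (\sum_i k i = \sum_i k' i)%N -> (forall i, k' i = q \/ k' i = q.+1) ->
  \sum_i inv_shift (k i) - \sum_i inv_shift (k' i) =
  \sum_i ((k i)%:R - q%:R) * ((k i)%:R - q.+1%:R) *
    (inv_shift (k i) * inv_shift q * inv_shift q.+1).
Proof.
move=> sum_k k'q; under [RHS]eq_bigr do rewrite -secant_gap.
pose gap j := inv_shift j - inv_shift q +
  (j%:R - q%:R) * (inv_shift q * inv_shift q.+1).
have gap_sum (f : 'I_r -> nat) : \sum_i gap (f i) = \sum_i inv_shift (f i) -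
    \sum_(i < r) inv_shift q +
    ((\sum_i f i)%:R - \sum_(i < r) q%:R) * (inv_shift q * inv_shift q.+1).
  by rewrite natr_sum -!sumrB mulr_suml -big_split.
have : \sum_i gap (k' i) = 0.
  apply: big1 => i _; rewrite /gap secant_gap.
  by case: (k'q i) => ->; rewrite subrr ?mulr0 !mul0r.
by rewrite -/(\sum_i gap (k i)) !gap_sum sum_k; lra.
Qed.

(** Meant for a centre class of size q + 1 + m, with h = 1 / (l + q) and g = 1 / ((l + k_c) (l + q +
    1)): the second term loses at most m g (2 Q + Q^2) <= 2 m h g, which [D] repays. *)
Lemma far_size_gain (q0 Q h m g D : R) : 0 <= q0 -> 0 <= m -> 0 <= g ->
  2 * Q + Q ^+ 2 <= 2 * h -> 0 <= D -> 2 * m * h * g <= D ->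
  0 <= (1 + q0) ^+ 2 * D + (Q - q0) * (2 + Q + q0) * (- m * g).
Proof.
move=> q0_ge0 m_ge0 g_ge0 hQ D_ge0 D_ge.
have : 0 <= (2 * q0 + q0 ^+ 2) * D by rewrite mulr_ge0 //; nra.
have : 0 <= m * g * (2 * h - (2 * Q + Q ^+ 2)).
  by rewrite !mulr_ge0 //; lra.
have : 0 <= m * g * (2 * q0 + q0 ^+ 2) by rewrite !mulr_ge0 //; nra.
by lra.
Qed.

(** With D the total secant gap and b the difference at the centre, the quantity is (1 + q0)^2 D +
    ((1 + Q)^2 - (1 + q0)^2) b. Only a centre class larger than q + 1 makes b negative, and then its
    own gap pays. *)
Lemma balance_gain (r q : nat) (k k' : 'I_r -> nat) (c c' : 'I_r) (q0 Q : R)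
    (a := \sum_(i | i != c) inv_shift (k i))
    (a' := \sum_(i | i != c') inv_shift (k' i)) :
  (\sum_i k i = \sum_i k' i)%N -> (forall i, k' i = q \/ k' i = q.+1) ->
  k' c' = q.+1 -> 0 <= q0 <= Q -> (2 * Q + Q ^+ 2) * (l + q%:R) <= 2 ->
  0 <= (1 + q0) ^+ 2 * (a - a') +
       (1 + Q) ^+ 2 * (inv_shift (k c) - inv_shift (k' c')).
Proof.
move=> sum_k k'q k'c /andP[q0_ge0 q0Q] Q_le.
have Qq0_ge0 : 0 <= (Q - q0) * (2 + Q + q0).
  by rewrite mulr_ge0 ?subr_ge0 // !addr_ge0 // (le_trans q0_ge0).
have gapE := sum_secant_gap sum_k k'q.
set D := \sum_i _ * _ in gapE.
rewrite (bigD1 c) //= [X in _ - X](bigD1 c') //= -/a -/a' in gapE.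
pose b := inv_shift (k c) - inv_shift (k' c').
have -> : a - a' = D - b by rewrite /b -gapE; ring.
rewrite -/b; have -> : (1 + q0) ^+ 2 * (D - b) + (1 + Q) ^+ 2 * b =
  (1 + q0) ^+ 2 * D + (Q - q0) * (2 + Q + q0) * b by ring.
have h_ge0 j : 0 <= inv_shift j by exact: ltW (inv_shift_gt0 j).
have term_ge0 i : 0 <= ((k i)%:R - q%:R) * ((k i)%:R - q.+1%:R) *
    (inv_shift (k i) * inv_shift q * inv_shift q.+1).
  by rewrite mulr_ge0 ?consecutive_prod_ge0 // !mulr_ge0.
have D_ge0 : 0 <= D by apply: sumr_ge0.
have hq : 2 * Q + Q ^+ 2 <= 2 * inv_shift q.
  by rewrite ler_pdivlMr // ltr_wpDr.
have [kc|kc] := leqP (k c) q.+1.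
  apply: addr_ge0; first by rewrite mulr_ge0 ?sqr_ge0.
  apply: mulr_ge0 => //.
  by rewrite subr_ge0 k'c lef_pV2 ?posrE ?ltr_wpDr // lerD2l ler_nat.
set m : R := ((k c)%:R - q.+1%:R).
have m_ge1 : 1 <= m by rewrite /m -(@natrB R) ?ler1n ?subn_gt0 // ltnW.
have -> : b = - m * (inv_shift (k c) * inv_shift q.+1).
  rewrite /b k'c /m /inv_shift; field.
  by rewrite nat1r !inv_shift_neq0.
have g_ge0 : 0 <= inv_shift (k c) * inv_shift q.+1 by rewrite mulr_ge0.
have m_ge0 : 0 <= m by exact: le_trans m_ge1.
apply: (far_size_gain _ _ _ hq) => //.
apply: (@le_trans _ _ (((k c)%:R - q%:R) * ((k c)%:R - q.+1%:R) *
    (inv_shift (k c) * inv_shift q * inv_shift q.+1))); last first.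
  by rewrite /D (bigD1 c) //= lerDl sumr_ge0.
(* The gap of class [c] is m (m + 1) h g, at least 2 m h g since m >= 1. *)
rewrite -/m; have -> : (k c)%:R - q%:R = m + 1 by rewrite /m -natr1; ring.
rewrite -subr_ge0 (_ : _ - _ = (m - 1) * m * inv_shift q *
  (inv_shift (k c) * inv_shift q.+1)); last by ring.
by rewrite !mulr_ge0 // subr_ge0.
Qed.

(** The total secant gap is zero and its terms are nonnegative, so each of them vanishes. *)
Lemma balanced_sizes (r q : nat) (k k' : 'I_r -> nat) (c c' : 'I_r) :
  (\sum_i k i = \sum_i k' i)%N -> (forall i, k' i = q \/ k' i = q.+1) ->
  \sum_(i | i != c) inv_shift (k i) = \sum_(i | i != c') inv_shift (k' i) ->
  inv_shift (k c) = inv_shift (k' c') ->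
  k c = k' c' /\ forall i, k i = q \/ k i = q.+1.
Proof.
move=> sum_k k'q eq_sum eq_c; split.
  by move/invr_inj/addrI/eqP: eq_c; rewrite eqr_nat => /eqP.
have := sum_secant_gap sum_k k'q.
rewrite (bigD1 c) //= [X in _ - X](bigD1 c') //= eq_sum eq_c subrr.
move/esym/eqP; rewrite psumr_eq0 => [/allP gap0 i|i _]; last first.
  rewrite mulr_ge0 ?consecutive_prod_ge0 //.
  by rewrite !mulr_ge0 // ltW // inv_shift_gt0.
have /eqP := implyP (gap0 i (mem_index_enum i)) isT.
move/eqP; rewrite mulf_eq0 => /orP[/eqP|]; first exact: consecutive_prod_eq0.
by rewrite gt_eqF // !mulr_gt0 // inv_shift_gt0.
Qed.

End Balance.

(** * Comparison of two star-deleted graphs through a test vector *)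

Section Compare.
Local Open Scope ring_scope.
Variables (R : realType) (r : nat).

Lemma sum_transversal_affine (k : 'I_r -> nat) (c : 'I_r) (l A B : R) :
  \sum_(i | i != c) (A * inv_shift l (k i) - B) =
  A * (\sum_(i | i != c) inv_shift l (k i)) - r.-1%:R * B.
Proof.
rewrite sumrB -mulr_sumr; congr (_ - _).
by rewrite sumr_const cardC1 card_ord mulr_natl.
Qed.

(** For l >= 1 the quadratic part is at least a^2 + b^2. *)
Lemma gain_eq0 (l q0 Q a b : R) : 1 <= l ->
  l * (a * (1 + q0) + b * (1 + Q)) + l ^+ 2 * (a + b) ^+ 2 - 2 * a * b <= 0 ->
  0 <= a * (1 + q0) + b * (1 + Q) -> a = 0 /\ b = 0.
Proof.
move=> l_ge1 le0 ge0; have l_ge0 : 0 <= l by lra.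
have h1 : 0 <= l * (a * (1 + q0) + b * (1 + Q)) by rewrite mulr_ge0.
have h2 : 0 <= (l ^+ 2 - 1) * (a + b) ^+ 2.
  by rewrite mulr_ge0 ?sqr_ge0 // subr_ge0 exprn_ege1.
have a2 := sqr_ge0 a; have b2 := sqr_ge0 b.
have h3 : a ^+ 2 + b ^+ 2 <= 0 by lra.
by split; apply/eqP; rewrite -sqrf_eq0; apply/eqP; lra.
Qed.

Section TwoStars.
Variables (V H : finType) (col : V -> 'I_r) (t : 'I_r -> V) (c : 'I_r).
Variables (col' : H -> 'I_r) (t' : 'I_r -> H) (c' : 'I_r).
Hypotheses (tK : cancel t col) (tK' : cancel t' col').
Variables (l : R) (x : V -> R).
Hypothesis l_gt0 : 0 < l.
Hypothesis x1 : \sum_v x v = 1.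
Hypothesis xeig :
  forall u, \sum_v (star_minus_rel col t c u v)%:R * x v = l * x u.

Let q0 := x (t c) / l.
Let Q := (\sum_(i | i != c) x (t i)) / l.
Let gain_leaf := (1 + q0) *
  (\sum_(i | i != c) inv_shift l (class_size col i) -
   \sum_(i | i != c') inv_shift l (class_size col' i)).
Let gain_center := (1 + Q) *
  (inv_shift l (class_size col c) - inv_shift l (class_size col' c')).

(** Compared with [x], the test vector has its leaf sum lowered by [gain_leaf], its centre entry
    lowered by [gain_center], and its total raised by l times both. In [star_test_qform] the
    constant terms then cancel. *)
Lemma star_test_gain (z := star_test col' t' c' l q0 Q) :
  qform (star_minus_rel col' t' c') z - l * sqnorm z =
  l * (gain_leaf * (1 + q0) + gain_center * (1 + Q)) +
  l ^+ 2 * (gain_leaf + gain_center) ^+ 2 - 2 * gain_leaf * gain_center.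
Proof.
have l_neq0 : l != 0 by rewrite gt_eqF.
have rE : r%:R = 1 + r.-1%:R :> R.
  by rewrite nat1r prednK // (leq_ltn_trans _ (ltn_ord c)).
have x_class := star_eigen_class tK l_gt0 x1 xeig.
pose P := \sum_(i | i != c) x (t i); rewrite -/P in x_class.
have lq0 : l * q0 = x (t c) by rewrite /q0 mulrC divfK.
have lQ : l * Q = P by rewrite /Q -/P mulrC divfK.
have [xtc xc] := x_class c; rewrite eqxx -/(inv_shift l _) in xtc xc.
pose a := \sum_(i | i != c) inv_shift l (class_size col i).
pose a' := \sum_(i | i != c') inv_shift l (class_size col' i).
have PE : l * P = (l + x (t c)) * a - r.-1%:R * x (t c).
  rewrite -sum_transversal_affine /P mulr_sumr; apply: eq_bigr => i ic.
  by have [->] := x_class i; rewrite (negPf ic).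
(* The normalisation of [x], written through the class sizes, trades the term [r] in the total of
   [z] for 1. *)
have oneE : 1 = r%:R - (l + P) * inv_shift l (class_size col c) -
    (l + x (t c)) * a.
  rewrite -[LHS]x1 -(sum_class_sum col) (bigD1 c) //= xc.
  rewrite (eq_bigr
    (fun i => 1 - (l + x (t c)) * inv_shift l (class_size col i))).
    rewrite sumrB -mulr_sumr sumr_const cardC1 card_ord -/a.
    by rewrite [r%:R]rE; ring.
  by move=> i /negPf ic; have [_ ->] := x_class i; rewrite ic.
have zc : z (t' c') = (1 + Q) * inv_shift l (class_size col' c') - Q.
  by rewrite /z /star_test tK' !eqxx mul1r.
have zP : \sum_(i | i != c') z (t' i) = (1 + q0) * a' - r.-1%:R * q0.
  rewrite -sum_transversal_affine; apply: eq_bigr => i /negPf ic.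
  by rewrite /z /star_test tK' ic !eqxx mul1r.
have zE : \sum_v z v = r%:R - l * (1 + Q) * inv_shift l (class_size col' c') -
    l * (1 + q0) * a'.
  rewrite -(sum_class_sum col') (bigD1 c') //= star_test_class // eqxx.
  rewrite (eq_bigr
    (fun i => 1 - l * (1 + q0) * inv_shift l (class_size col' i))).
    rewrite sumrB -mulr_sumr sumr_const cardC1 card_ord -/a'.
    by rewrite [r%:R]rE -/(inv_shift _ _); ring.
  by move=> i /negPf ic; rewrite star_test_class // ic -/(inv_shift _ _); ring.
have zcE : z (t' c') = l * q0 - gain_center.
  rewrite zc lq0 /gain_center; apply: (mulfI l_neq0).
  by rewrite (mulrBr l (x (t c))) xtc -lQ; ring.
have zPE : \sum_(i | i != c') z (t' i) = l * Q - gain_leaf.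
  rewrite zP lQ /gain_leaf -/a -/a'; apply: (mulfI l_neq0).
  by rewrite (mulrBr l P) PE -lq0; ring.
have zE' : \sum_v z v = 1 + l * (gain_leaf + gain_center).
  by rewrite zE [in RHS]oneE -lQ -lq0 /gain_leaf /gain_center -/a -/a'; ring.
rewrite star_test_qform // -/z zE' zPE zcE; ring.
Qed.

(** The test vector cannot beat [l] on the second graph, while [balance_gain] makes the linear part
    of its surplus nonnegative; hence both gains vanish. *)
Lemma star_compare (q : nat) : 1 <= l -> #|V| = #|H| ->
  0 <= x (t c) <= \sum_(i | i != c) x (t i) ->
  (2 * Q + Q ^+ 2) * (l + q%:R) <= 2 ->
  (forall i, class_size col' i = q \/ class_size col' i = q.+1) ->
  class_size col' c' = q.+1 ->
  (forall y, qform (star_minus_rel col' t' c') y <= l * sqnorm y) ->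
  class_size col c = class_size col' c' /\
  forall i, class_size col i = q \/ class_size col i = q.+1.
Proof.
move=> l_ge1 VH /andP[xtc_ge0 xtc_le] Q_le size' sizec' lmax.
have sum_size : (\sum_i class_size col i = \sum_i class_size col' i)%N.
  by rewrite !sum_class_size.
have q0_ge0 : 0 <= q0 by rewrite divr_ge0 // ltW.
have q0Q : q0 <= Q by rewrite ler_pM2r ?invr_gt0.
have q0Q' : 0 <= q0 <= Q by rewrite q0_ge0.
have gain := balance_gain l_gt0 c sum_size size' sizec' q0Q' Q_le.
have := lmax (star_test col' t' c' l q0 Q); rewrite -subr_le0 star_test_gain.
move/(gain_eq0 l_ge1) => [|leaf0 center0].
  by congr (0 <= _): gain; rewrite /gain_leaf /gain_center; ring.
have q01 : 1 + q0 != 0 by rewrite gt_eqF // ltr_wpDr.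
have Q1 : 1 + Q != 0 by rewrite gt_eqF // ltr_wpDr // (le_trans q0_ge0).
apply: (balanced_sizes l_gt0 sum_size size').
  by move/eqP: leaf0; rewrite mulf_eq0 (negPf q01) subr_eq0 => /eqP.
by move/eqP: center0; rewrite mulf_eq0 (negPf Q1) subr_eq0 => /eqP.
Qed.

End TwoStars.
End Compare.

(** * Isomorphism of star-deleted graphs *)

Section Matching.

(** The k-th element of each fibre of [f] goes to the k-th element of the fibre of [g] over the same
    value. *)
Lemma fiber_injection (A B : finType) (C : eqType) (f : A -> C) (g : B -> C) :
  (forall c, #|[pred a | f a == c]| <= #|[pred b | g b == c]|) ->
  exists2 h : A -> B, injective h & forall a, g (h a) = f a.
Proof.
move=> fg; have [b0 _|B0] := pickP (@predT B); last first.
  have noA (a : A) : False.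
    have := fg (f a); rewrite [leqRHS]eq_card0 => [|b]; last by have := B0 b.
    by rewrite leqn0 => /eqP/card0_eq/(_ a); rewrite !inE eqxx.
  by exists (fun a => False_rect B (noA a)) => a; case: (noA a).
pose fA a := enum [pred a' | f a' == f a].
pose gB a := enum [pred b | g b == f a].
pose h a := nth b0 (gB a) (index a (fA a)).
have idx a : index a (fA a) < size (gB a).
  apply: (@leq_trans (size (fA a))); first by rewrite index_mem mem_enum inE.
  by rewrite -!cardE fg.
have gh a : g (h a) = f a.
  by have := mem_nth b0 (idx a); rewrite mem_enum inE => /eqP.
exists h => // a a' haa'.
have faa' : f a = f a' by rewrite -!gh haa'.
have fAE : fA a = fA a' by rewrite /fA faa'.
have gBE : gB a = gB a' by rewrite /gB faa'.
have : index a (fA a) = index a' (fA a').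
  apply/eqP; rewrite -(nth_uniq b0 (idx a) _ (enum_uniq _)).
    by move: haa'; rewrite /h gBE => ->.
  by rewrite gBE.
rewrite fAE => /(congr1 (nth a (fA a'))).
by rewrite !nth_index ?mem_enum ?inE // faa'.
Qed.

Lemma fiber_bijection (A B : finType) (C : eqType) (f : A -> C) (g : B -> C) :
  (forall c, #|[pred a | f a == c]| = #|[pred b | g b == c]|) ->
  exists2 h : A -> B, bijective h & forall a, g (h a) = f a.
Proof.
move=> fg; have [|h h_inj gh] := @fiber_injection A B C f g.
  by move=> c; rewrite fg.
have [|h' h'_inj _] := @fiber_injection B A C g f; first by move=> c; rewrite fg.
by exists h => //; apply: inj_card_bij => //; apply: leq_card h'_inj.
Qed.

Lemma card_two_values (r q : nat) (k : 'I_r -> nat) :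
  (forall i, k i = q \/ k i = q.+1) ->
  \sum_i k i = r * q + #|[pred i | k i == q.+1]|.
Proof.
move=> kq; rewrite -sum1_card [in RHS]big_mkcond.
have -> : r * q = \sum_(i < r) q by rewrite sum_nat_const card_ord.
rewrite -big_split; apply: eq_bigr => i _ /=; rewrite inE.
by case: (kq i) => ->; rewrite ?eqxx ?addn1 // -[_ == _]negbK neq_ltn ltnSn addn0.
Qed.

(** With only two possible sizes, the total fixes how many classes have size q + 1. *)
Lemma card_size_eq (r q : nat) (k k' : 'I_r -> nat) :
  (forall i, k i = q \/ k i = q.+1) -> (forall i, k' i = q \/ k' i = q.+1) ->
  \sum_i k i = \sum_i k' i ->
  forall m, #|[pred i | k i == m]| = #|[pred i | k' i == m]|.
Proof.
move=> kq k'q; rewrite (card_two_values kq) (card_two_values k'q).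
move/addnI => big_eq m.
have card_q (f : 'I_r -> nat) : (forall i, f i = q \/ f i = q.+1) ->
    #|[pred i | f i == q]| = r - #|[pred i | f i == q.+1]|.
  move=> fq; rewrite -[r in r - _]card_ord -(cardC [pred i | f i == q.+1]) addKn.
  apply: eq_card => i; rewrite !inE; case: (fq i) => ->; rewrite eqxx.
    by rewrite neq_ltn ltnSn.
  by rewrite eqn_leq ltnn.
have [->|mq1] := eqVneq m q.+1; first exact: big_eq.
have [->|mq] := eqVneq m q; first by rewrite !card_q // big_eq.
rewrite !eq_card0 // => i; rewrite !inE; apply/negbTE.
  by case: (k'q i) => ->; rewrite eq_sym.
by case: (kq i) => ->; rewrite eq_sym.
Qed.

Lemma card_marked (T : finType) (C : eqType) (f : T -> C) (x : T) (b : bool) (m : C) :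
  #|[pred y | (y == x, f y) == (b, m)]| =
  if b then (f x == m) : nat else #|[pred y | f y == m]| - (f x == m).
Proof.
case: b.
  have [fx|fx] := eqVneq (f x) m.
    rewrite /= -(card1 x); apply: eq_card => y; rewrite !inE /= xpair_eqE eqb_id.
    by case: eqP => // ->; rewrite fx eqxx.
  rewrite eq_card0 // => y; rewrite !inE /= xpair_eqE eqb_id.
  by case: eqP => // ->; rewrite (negPf fx).
rewrite [in RHS](cardD1 x) inE addKn; apply: eq_card => y.
by rewrite !inE /= xpair_eqE eqbF_neg.
Qed.

(** First the classes are matched by size with the centre class marked by a Boolean, then the
    vertices class by class with the roots marked. *)
Lemma star_minus_iso (r q : nat) (V H : finType)
    (col : V -> 'I_r) (t : 'I_r -> V) (c : 'I_r)
    (col' : H -> 'I_r) (t' : 'I_r -> H) (c' : 'I_r) :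
  cancel t col -> cancel t' col' -> #|V| = #|H| ->
  (forall i, class_size col i = q \/ class_size col i = q.+1) ->
  (forall i, class_size col' i = q \/ class_size col' i = q.+1) ->
  class_size col c = class_size col' c' ->
  exists2 h : V -> H, bijective h & forall u v,
    star_minus_rel col' t' c' (h u) (h v) = star_minus_rel col t c u v.
Proof.
move=> tK tK' VH kq k'q kc.
have card_eq := card_size_eq kq k'q.
have [|p p_bij pE] := @fiber_bijection _ _ _
    (fun i => (i == c, class_size col i)) (fun i => (i == c', class_size col' i)).
  by move=> [b m]; rewrite !card_marked kc card_eq // !sum_class_size.
have p_inj := bij_inj p_bij.
have pc i : (p i == c') = (i == c) by have [] := pE i.
have psize i : class_size col' (p i) = class_size col i by have [] := pE i.
have markE (W : finType) (cl : W -> 'I_r) (s : 'I_r -> W) j b : cancel s cl ->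
    #|[pred v | (cl v, v == s (cl v)) == (j, b)]| =
    if b then 1 else class_size cl j - 1.
  move=> sK; case: b.
    rewrite -(card1 (s j)); apply: eq_card => v; rewrite !inE /= xpair_eqE eqb_id.
    by apply/andP/eqP => [[/eqP -> /eqP]|->]; rewrite ?sK.
  rewrite /class_size [in RHS](cardD1 (s j)) inE sK eqxx addKn.
  apply: eq_card => v; rewrite !inE /= xpair_eqE eqbF_neg andbC.
  by apply: andb_id2r => /eqP ->.
have [|h h_bij hE] := @fiber_bijection V H _
    (fun v => (p (col v), v == t (col v))) (fun v => (col' v, v == t' (col' v))).
  move=> [j b]; rewrite markE // -(f_invF p_inj j).
  set i := invF _ _; rewrite psize -(markE _ _ _ i b tK).
  by apply: eq_card => v; rewrite !inE !xpair_eqE (inj_eq p_inj).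
have hcol v : col' (h v) = p (col v) by have [] := hE v.
have ht v : (h v == t' (p (col v))) = (v == t (col v)).
  by have [_] := hE v; rewrite hcol.
have pcE : p c = c' by apply/eqP; rewrite pc.
have htc v : (h v == t' c') = (v == t c).
  apply/eqP/eqP => hv.
    have vc : col v = c.
      by apply/eqP; rewrite -pc -hcol hv tK'.
    by apply/eqP; have := ht v; rewrite vc pcE hv eqxx.
  by apply/eqP; have := ht (t c); rewrite tK pcE eqxx -hv.
exists h => // u v; rewrite /star_minus_rel /star_rel !hcol (inj_eq p_inj).
by rewrite !htc !ht !pc.
Qed.

End Matching.

(** * The graph T_r^-(n) *)

Section TuranMinusStar.
Variables (r n : nat).
Hypotheses (r_gt0 : 0 < r) (r_le_n : r <= n).

Lemma turan_size_gt0 (i : 'I_r) : 0 < turan_size n i.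
Proof. by rewrite addn_gt0 divn_gt0 // r_le_n. Qed.

Definition turan_class (x : turan_minus r n) : 'I_r := tag x.
Definition turan_root (i : 'I_r) : turan_minus r n :=
  Tagged (fun i : 'I_r => 'I_(turan_size n i)) (Ordinal (turan_size_gt0 i)).
Definition turan_top : 'I_r := Ordinal r_gt0.

Lemma turan_rootK : cancel turan_root turan_class.
Proof. by []. Qed.

Lemma turan_root_eq (x : turan_minus r n) :
  (x == turan_root (turan_class x)) = (tagged x == 0 :> nat).
Proof. by case: x => i j; rewrite /turan_class /= eq_Tagged. Qed.

Lemma turan_minus_star (x y : turan_minus r n) :
  adj x y = star_minus_rel turan_class turan_root turan_top x y.
Proof.
have topE (u : turan_minus r n) : (u == turan_root turan_top) = star_center u.
  rewrite /star_center -turan_root_eq; apply/eqP/andP => [->|[/eqP u0 /eqP uE]].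
    by rewrite turan_rootK.
  by rewrite {1}uE; congr turan_root; exact: val_inj.
have leafE (u : turan_minus r n) :
  (u == turan_root (turan_class u)) && (turan_class u != turan_top) = star_leaf u.
  by rewrite turan_root_eq andbC.
by rewrite /star_minus_rel /star_rel !topE !leafE.
Qed.

Lemma turan_class_size (i : 'I_r) : class_size turan_class i = turan_size n i.
Proof.
pose f (j : 'I_(turan_size n i)) : turan_minus r n :=
  Tagged (fun i : 'I_r => 'I_(turan_size n i)) j.
have f_inj : injective f by move=> j k /eqP; rewrite eq_Tagged => /eqP.
rewrite -[RHS]card_ord -(card_image f_inj); apply: eq_card => x; rewrite !inE.
apply/eqP/imageP => [|[j _ ->]] //; case: x => i' j /= ii'.
by move: j; rewrite /turan_class /= in ii'; rewrite ii' => j; exists j.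
Qed.

Lemma card_turan_minus : #|turan_minus r n| = n.
Proof.
rewrite -(sum_class_size turan_class) -[RHS](turan_size_sum n r_gt0).
by apply: eq_bigr => i _; rewrite turan_class_size.
Qed.

(** Counting down from the largest size gives the top class size q + 1 even when [r] divides [n];
    then all classes have size q + 1. *)
Lemma turan_top_size (q := (turan_size n turan_top).-1) :
  turan_size n turan_top = q.+1 /\
  forall i : 'I_r, turan_size n i = q \/ turan_size n i = q.+1.
Proof.
have topE : turan_size n turan_top = q.+1 by rewrite prednK // turan_size_gt0.
split=> // i; have := @turan_size_noninc r n turan_top i isT.
have := turan_size_balanced n turan_top i.
rewrite topE leq_subLR addn1 ltnS leq_eqVlt => /orP[/eqP->|qi le]; first by left.
by right; apply/eqP; rewrite eqn_leq le.
Qed.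

End TuranMinusStar.

(** * A lower bound for the spectral radius of T_r^-(n) *)

Section TuranMinusRadius.
Local Open Scope ring_scope.

(** The all-ones vector is the test vector. The star costs 2 (r - 1) and the imbalance of the
    classes at most r / 4, whence 9 / 4. *)
Lemma turan_minus_radius (R : realType) (r n : nat) : (0 < r)%N -> (r <= n)%N ->
  (1 - r%:R^-1) * n%:R ^+ 2 - 9 / 4 * r%:R <=
  spectral_radius R (turan_minus r n) * n%:R.
Proof.
move=> r_gt0 r_le_n; have n_gt0 : (0 < n)%N by exact: leq_trans r_le_n.
have [|_ [_ _ _ lmax]] := @spectral_radiusP R (turan_minus r n).
  by rewrite card_turan_minus.
have := lmax (fun=> 1).
have -> : sqnorm (fun _ : turan_minus r n => 1) = n%:R :> R.
  by rewrite /sqnorm sumr_const expr1n card_turan_minus.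
apply: le_trans.
have -> : @adj (turan_minus r n) =
    star_minus_rel (@turan_class r n) (turan_root r_gt0 r_le_n) (turan_top r_gt0).
  by apply/funext => x; apply/funext => y; exact: turan_minus_star.
rewrite star_minus_qform; last exact: turan_rootK.
rewrite sumr_const card_turan_minus // sumr_const cardC1 card_ord mulr1.
have [topE sizeE] := turan_top_size r_gt0 r_le_n.
set q := _.-1 in topE sizeE.
(* Each size k satisfies (k - q) (k - q - 1) = 0, which makes k^2 affine in k. *)
have -> : \sum_i class_sum (@turan_class r n) (fun=> 1) i ^+ 2 =
    (2 * q%:R + 1) * n%:R - r%:R * (q%:R * (q%:R + 1)) :> R.
  have -> : n%:R = \sum_(i < r) (turan_size n i)%:R :> R.
    by rewrite -natr_sum turan_size_sum.
  have -> : r%:R * (q%:R * (q%:R + 1)) = \sum_(i < r) q%:R * (q%:R + 1) :> R.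
    by rewrite sumr_const card_ord mulr_natl.
  rewrite mulr_sumr -sumrB; apply: eq_bigr => i _.
  rewrite /class_sum sum_class_const turan_class_size // mulr1.
  by case: (sizeE i) => ->; rewrite -?natr1; ring.
have r_neq0 : r%:R != 0 :> R by rewrite pnatr_eq0 -lt0n.
have r_ge0 : 0 < r%:R :> R by rewrite ltr0n.
have r1E : r.-1%:R = r%:R - 1 :> R by rewrite -[in RHS](prednK r_gt0) -natr1; ring.
rewrite r1E -subr_ge0.
have : 0 <= r%:R^-1 * (n%:R - r%:R * (q%:R + 1 / 2)) ^+ 2 :> R.
  by rewrite mulr_ge0 ?sqr_ge0 // invr_ge0 ltW.
have -> : r%:R^-1 * (n%:R - r%:R * (q%:R + 1 / 2)) ^+ 2 =
  r%:R^-1 * n%:R ^+ 2 - 2 * n%:R * (q%:R + 1 / 2) +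
  r%:R * (q%:R + 1 / 2) ^+ 2 :> R by field.
lra.
Qed.

End TuranMinusRadius.

(** * Almost extremal graphs are r-partite *)

(** Distinct indices have adjacent, hence distinct, images. A free index type covers both vertex
    subsets and [option 'I_r]. *)
Lemma clique_free_card (k : nat) (G : sgraph) (T : finType) (f : T -> G) :
  clique_free k.+1 G -> (forall x y, x != y -> adj (f x) (f y)) -> #|T| <= k.
Proof.
move=> Gfree f_adj; rewrite leqNgt; apply/negP => kT; apply: Gfree.
have f_inj : injective f.
  move=> x y fxy; apply/eqP; case: eqVneq => // /f_adj.
  by rewrite fxy adj_irrefl.
pose g (i : complete_graph k.+1) : T := enum_val (widen_ord kT i).
have g_inj : injective g 
  by move=> i j /enum_val_inj/(congr1 val) ij; apply: val_inj.
exists (f \o g) => [|i j ij]; first exact: inj_comp.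
by apply: f_adj; rewrite (inj_eq g_inj).
Qed.

Section NearTuran.
Local Open Scope ring_scope.

Lemma sum_sq_deviation (R : realType) (T : finType) (x : T -> R) :
  \sum_v (x v - (\sum_u x u) / #|T|%:R) ^+ 2 =
  \sum_v x v ^+ 2 - (\sum_v x v) ^+ 2 / #|T|%:R.
Proof.
have [T0|T_neq0] := eqVneq (#|T|%:R : R) 0.
  have noT (v : T) : False.
    move/eqP: T0; rewrite pnatr_eq0 => /eqP/card0_eq/(_ v).
    by rewrite inE.
  by rewrite !big1 ?expr0n ?mul0r ?subr0 // => v; case: (noT v).
set S := \sum_u x u.
transitivity (\sum_v (x v ^+ 2 - 2 * (S / #|T|%:R) * x v + (S / #|T|%:R) ^+ 2)).
  by apply: eq_bigr => v _; ring.
rewrite big_split sumrB -mulr_sumr -/S sumr_const -mulr_natl /=.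
by field.
Qed.

Lemma sum_cross (R : realType) (V : finType) (r : nat) (col : V -> 'I_r)
    (x : V -> R) :
  \sum_u \sum_v (col u != col v)%:R * (x u * x v) =
  (\sum_v x v) ^+ 2 - \sum_i class_sum col x i ^+ 2.
Proof.
have -> : \sum_i class_sum col x i ^+ 2 = \sum_v x v * class_sum col x (col v).
  by rewrite sum_mul_class.
rewrite expr2 mulr_suml -sumrB; apply: eq_bigr => u _.
rewrite /class_sum [X in _ = _ - _ * X]big_mkcond !mulr_sumr -sumrB.
by apply: eq_bigr => v _; rewrite eq_sym; case: eqP => _ /=; ring.
Qed.

(** In these numerical lemmas [W] and [T] are the sums of squared deviations of the entries and of
    the class sums from their means, [Z] the sum of squared class sums, [I] the weight inside
    classes, [S] the total, and [ri] is 1 / r. *)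
Lemma deficit_bound (R : realType) (l n r ri I T W Z : R) :
  l * n + I <= n * (n - W) - Z -> (1 - ri) * n ^+ 2 - 9 / 4 * r <= l * n ->
  Z = T + n * (n - W) * ri ->
  I + T + (1 - ri) * (n * W) <= 9 / 4 * r.
Proof. by lra. Qed.

(** The missing weight exceeds [I] by at most 9 r / 4, and [I] is itself at most 9 r / 4. *)
Lemma missing_bound (R : realType) (l n r ri I T W Z : R) :
  (1 - ri) * n ^+ 2 - 9 / 4 * r <= l * n ->
  Z = T + n * (n - W) * ri -> I + T + (1 - ri) * (n * W) <= 9 / 4 * r ->
  0 <= (1 - ri) * (n * W) -> 0 <= I -> 0 <= T ->
  n * (n - W) - Z - (l * n - I) <= 9 / 2 * r.
Proof. by lra. Qed.

Lemma sum_lower_bound (R : realType) (r n S W : R) :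
  2 <= r -> 65 * r ^+ 2 <= n -> 0 <= S -> n * W <= 9 / 2 * r ->
  S ^+ 2 = n * (n - W) -> 9 / 10 * n <= S.
Proof.
move=> r2 n65 S0 nW S2; have n_gt : 130 * r <= n by nra.
rewrite leNgt; apply/negP => S_lt.
have : S ^+ 2 <= 9 / 10 * n * (9 / 10 * n).
  by rewrite expr2; apply: ler_pM => //; exact: ltW.
have : 130 * r * 130 <= n * n by apply: le_trans (_ : 130 * r * n <= _); nra.
by rewrite S2; lra.
Qed.

(** W <= 1 / 25 keeps the entry within 1 / 5 of a mean that is at least 9 / 10. *)
Lemma entry_lower_bound (R : realType) (r n S W y : R) :
  2 <= r -> 65 * r ^+ 2 <= n -> 9 / 10 * n <= S -> n * W <= 9 / 2 * r ->
  (y - S / n) ^+ 2 <= W -> 1 / 2 <= y.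
Proof.
move=> r2 n65 S_ge nW yW; have n_gt : 130 * r <= n by nra.
have n_gt0 : 0 < n by lra.
have : 9 / 10 <= S / n by rewrite ler_pdivlMr.
have : W <= 1 / 25 by rewrite -(ler_pM2l n_gt0); lra.
move: (S / n) yW => s yW W_le s_ge; nra.
Qed.

(** The quadratic bound on n gives S / r >= 50 r, while the deviation is at most 3 / 2 times the
    square root of r. *)
Lemma class_lower_bound (R : realType) (r n S X : R) :
  2 <= r -> 65 * r ^+ 2 <= n -> 9 / 10 * n <= S ->
  (X - S / r) ^+ 2 <= 9 / 4 * r -> 10 * r <= X.
Proof.
move=> r2 n65 S_ge XS; have r_gt0 : 0 < r by lra.
have : 50 * r <= S / r by rewrite ler_pdivlMr //; nra.
move: (S / r) XS => s XS s_ge; nra.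
Qed.

Lemma deficit_split (R : realType) (r n W I T : R) :
  2 <= r -> 65 * r ^+ 2 <= n -> 0 <= T -> 0 <= W -> 0 <= I ->
  I + T + (1 - r^-1) * (n * W) <= 9 / 4 * r ->
  n * W <= 9 / 2 * r /\ T <= 9 / 4 * r.
Proof.
move=> r2 n65 T0 W0 I0 total; have n0 : 0 <= n by nra.
have nW0 : 0 <= n * W by rewrite mulr_ge0.
have : 0 <= (2^-1 - r^-1) * (n * W).
  by rewrite mulr_ge0 // subr_ge0 lef_pV2 // posrE; lra.
by split; lra.
Qed.

Lemma bad_class_absurd (R : realType) (r X M : R) : M <= 9 / 2 * r -> 0 < r ->
  10 * r <= X -> 1 / 2 * X <= M -> False.
Proof. by lra. Qed.

Section Fixed.
Variables (R : realType) (r n : nat) (G : sgraph) (l : R) (x : G -> R).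
Hypotheses (r_ge2 : (2 <= r)%N) (n_ge : (65 * r ^ 2 <= n)%N).
Hypothesis G_order : #|G| = n.
Hypothesis G_free : clique_free r.+1 G.
Hypothesis x_ge0 : forall v, 0 <= x v.
Hypothesis x_norm : sqnorm x = n%:R.
Hypothesis x_form : qform (@adj G) x = l * n%:R.
Hypothesis l_ge : (1 - r%:R^-1) * n%:R ^+ 2 - 9 / 4 * r%:R <= l * n%:R.

Lemma order_ge : 2 <= r%:R :> R /\ 65 * r%:R ^+ 2 <= n%:R :> R.
Proof. by split; rewrite -?natrX -?natrM ler_nat. Qed.

(* A single deficit of [9 r / 4] pays at once for the weight [I] inside the
   classes, the spread of the class sums, and the spread of [x]. *)
Lemma near_turan_deficit : exists col : G -> 'I_r,
  let S := \sum_v x v in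
  let I := \sum_u \sum_v (adj u v && (col u == col v))%:R * (x u * x v) in
  let M := \sum_u \sum_v (~~ adj u v && (col u != col v))%:R * (x u * x v) in
  [/\ I + \sum_i (class_sum col x i - S / r%:R) ^+ 2 +
      (1 - r%:R^-1) * (n%:R * \sum_v (x v - S / n%:R) ^+ 2) <= 9 / 4 * r%:R,
      M <= 9 / 2 * r%:R &
      S ^+ 2 = n%:R * (n%:R - \sum_v (x v - S / n%:R) ^+ 2)].
Proof.
have [r2 n65] := order_ge.
have clG (K : {set G}) :
    K \subset [set: G] -> clique (@adj G) K -> (#|K| <= r)%N.
  move=> _ Kcl; rewrite -card_sig.
  apply: (clique_free_card (f := fun u : {v | v \in K} => val u) G_free).
  move=> u v uv; apply: Kcl; try exact: valP.
  by rewrite (inj_eq val_inj).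
have [col0 col0r H] := weighted_turan (@adj_sym G) (@adj_irrefl G) x_ge0 clG.
pose col v : 'I_r := Ordinal (col0r v (in_setT v)).
exists col => S I M.
have sumT (f : G -> R) : \sum_(u in [set: G]) f u = \sum_u f u.
  by apply: eq_bigl => u; rewrite inE.
(* Edges inside classes count twice in the majorisation, hence the extra [I]. *)
have {}H : l * n%:R + I <= S ^+ 2 - \sum_i class_sum col x i ^+ 2.
  rewrite -sum_cross -x_form /qform /I -big_split /=.
  congr (_ <= _): H.
    rewrite sumT; apply: eq_bigr => u _.
    rewrite -big_split sumT /=; apply: eq_bigr => v _.
    by rewrite -mulnb natrM; ring.
  rewrite sumT; apply: eq_bigr => u _.
  by rewrite sumT; apply: eq_bigr.
have n_gt0 : 0 < n%:R :> R by nra.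
have r_gt0 : 0 < r%:R :> R by lra.
have := sum_sq_deviation x; rewrite G_order -/S.
rewrite [X in _ = X - _]x_norm.
set W := \sum_v _ => WE.
have := sum_sq_deviation (class_sum col x); rewrite sum_class_sum card_ord -/S.
set T := \sum_i _ => TE.
have S2 : S ^+ 2 = n%:R * (n%:R - W) by rewrite WE; field; rewrite gt_eqF.
have T_ge0 : 0 <= T by apply: sumr_ge0 => i _; exact: sqr_ge0.
have W_ge0 : 0 <= W by apply: sumr_ge0 => i _; exact: sqr_ge0.
have I_ge0 : 0 <= I.
  by apply: sumr_ge0 => u _; apply: sumr_ge0 => v _; rewrite !mulr_ge0.
have ZE : \sum_i class_sum col x i ^+ 2 = T + n%:R * (n%:R - W) / r%:R.
  by rewrite TE S2; ring.
rewrite S2 in H; have total := deficit_bound H l_ge ZE.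
split => //.
(* All pairs across classes, minus the edges across classes. *)
have -> : M = S ^+ 2 - \sum_i class_sum col x i ^+ 2 - (l * n%:R - I).
  rewrite -sum_cross -x_form /qform /I /M -!sumrB; apply: eq_bigr => u _.
  rewrite -!sumrB; apply: eq_bigr => v _.
  by case: (adj u v); case: (col u == col v) => /=; ring.
have rV_le1 : r%:R^-1 <= 1 :> R by rewrite invf_le1 //; lra.
have nW : 0 <= (1 - r%:R^-1) * (n%:R * W) by rewrite !mulr_ge0 ?subr_ge0 // ltW.
by rewrite S2; exact: missing_bound l_ge ZE total nW I_ge0 T_ge0.
Qed.

Lemma near_turan : exists col : G -> 'I_r,
  [/\ forall u v, adj u v -> col u != col v, forall v, 1 / 2 <= x v &
      forall i, exists v, col v = i].
Proof.
have [r2 n65] := order_ge.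
have [col] := near_turan_deficit.
set S := \sum_v x v; set I := \sum_u \sum_v _; set M := \sum_u \sum_v _.
move=> /= -[]; set T := \sum_i _; set W := \sum_v _ => total M_le S2.
have T_ge0 : 0 <= T by apply: sumr_ge0 => i _; exact: sqr_ge0.
have W_ge0 : 0 <= W by apply: sumr_ge0 => i _; exact: sqr_ge0.
have S_ge0 : 0 <= S by apply: sumr_ge0.
have I_ge0 : 0 <= I.
  by apply: sumr_ge0 => u _; apply: sumr_ge0 => v _; rewrite !mulr_ge0.
have [nW T_le] := deficit_split r2 n65 T_ge0 W_ge0 I_ge0 total.
have S_ge := sum_lower_bound r2 n65 S_ge0 nW S2.
have x_ge v : 1 / 2 <= x v.
  apply: (entry_lower_bound r2 n65 S_ge nW).
  by rewrite /W (bigD1 v) //= lerDl sumr_ge0 // => u _; exact: sqr_ge0.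
have X_ge i : 10 * r%:R <= class_sum col x i.
  apply: (class_lower_bound r2 n65 S_ge); apply: le_trans T_le.
  by rewrite /T (bigD1 i) //= lerDl sumr_ge0 // => j _; exact: sqr_ge0.
(* If each vertex of class i missed a vertex of another class, of weight at least 1 / 2, the missing
   weight would reach half the class sum, so at least 5 r > 9 r / 2. *)
have good i : exists2 w, col w = i & forall v, col v != i -> adj w v.
  have [/existsP[w /andP[/eqP wi /forallP w_good]]|] :=
    boolP [exists w, (col w == i) && [forall v, (col v != i) ==> adj w v]].
    by exists w => // v; exact/implyP.
  rewrite negb_exists => /forallP bad; exfalso.
  have : 1 / 2 * class_sum col x i <= M.
    rewrite mulr_sumr /M [leRHS](bigID (fun u => col u == i)) /=.
    apply: ler_wpDr.
      by do 2!rewrite sumr_ge0 // => ? _; rewrite !mulr_ge0.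
    apply: ler_sum => u ui.
    have := bad u; rewrite ui /= negb_forall => /existsP[v].
    rewrite negb_imply => /andP[vi uv].
    rewrite (bigD1 v) //= uv (eqP ui) eq_sym vi mul1r.
    apply: ler_wpDr; first by rewrite sumr_ge0 // => w _; rewrite !mulr_ge0.
    rewrite /= !mul1r mulrC; apply: ler_wpM2l => //.
    by rewrite -[leLHS]mul1r; exact: x_ge.
  have := X_ge i; have r_gt0 : 0 < r%:R :> R by lra.
  move: (class_sum _ _ _) M_le r_gt0 => X; exact: bad_class_absurd.
exists col; split=> // [u v uv|i]; last by have [w] := good i; exists w.
apply/eqP => uvc.
pose w i := s2val (cid2 (good i)).
have wcol i : col (w i) = i by rewrite /w; case: (cid2 _).
have wadj i z : col z != i -> adj (w i) z.
  by rewrite /w; case: (cid2 _) => /= ? _; exact.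
(* A K_{r+1}: the inner edge u v together with the fully joined vertices w i of the other classes;
   [None] stands for u. *)
pose f (o : option 'I_r) : G :=
  if o is Some i then if i == col u then v else w i else u.
have H := @clique_free_card r G _ f G_free.
rewrite card_option card_ord ltnn in H.
apply/negP: isT; rewrite -[true]H //.
move=> [i|] [j|] //= ij.
- have {}ij : i != j by apply: contraNneq ij => ->.
  have [iu|iu] := eqVneq i (col u); have [ju|ju] := eqVneq j (col u).
  + by rewrite iu ju eqxx in ij.
  + by rewrite adj_sym wadj // -uvc eq_sym.
  + by rewrite wadj // -uvc eq_sym.
  + by rewrite wadj // wcol eq_sym.
- case: eqVneq => [_|iu]; first by rewrite adj_sym.
  by rewrite wadj // eq_sym.
- case: eqVneq => [_|iu] //.
  by rewrite adj_sym wadj // eq_sym.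
Qed.

End Fixed.
End NearTuran.

(** * Graphs of maximal spectral radius *)

Section Extremal.
Local Open Scope ring_scope.
Variables (R : realType) (r : nat) (G : sgraph) (col : G -> 'I_r).
Hypothesis G_coconn : co_connected G.
Hypothesis col_proper : forall u v, adj u v -> col u != col v.
Hypothesis col_surj : forall i, exists v, col v = i.

Definition missing (u v : G) : bool := (col u != col v) && ~~ adj u v.

Lemma missing_sym : symmetric missing.
Proof. by move=> u v; rewrite /missing eq_sym adj_sym. Qed.

(** Otherwise the vertices with class in [A] would form a union of components of the complement,
    whose edges between classes are the missing pairs. *)
Lemma missing_boundary (A : {set 'I_r}) (i j : 'I_r) : i \in A -> j \notin A ->
  exists u v, [/\ col u \in A, col v \notin A & missing u v].
Proof.
move=> iA jA; have [u ui] := col_surj i; have [v vj] := col_surj j.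
have [/existsP[a /existsP[b /and3P[]]]|none] :=
    boolP [exists a, exists b, [&& col a \in A, col b \notin A & missing a b]].
  by exists a, b.
have noE a b : col a \in A -> missing a b -> col b \in A.
  move=> aA ab; apply: contraNT none => bA.
  by apply/existsP; exists a; apply/existsP; exists b; rewrite aA bA ab.
have step a b : compl_adj a b -> col a \in A -> col b \in A.
  move=> /andP[_ ab] aA; have [<- //|ab'] := eqVneq (col a) (col b).
  by apply: (noE a) => //; rewrite /missing ab' ab.
have cl : fingraph.closed (@adj (compl_graph G)) [pred a : G | col a \in A].
  move=> a b ab; rewrite !inE; apply/idP/idP; first exact: step.
  by apply: step; rewrite compl_adj_sym.
have [_ /(_ u v)] := G_coconn; move/(closed_connect cl).
by rewrite !inE ui vj iA (negPf jA).
Qed.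

Variable x : G -> R.
Hypothesis x_gt0 : forall v, 0 < x v.

Lemma exists_min_transversal : exists t : 'I_r -> G,
  cancel t col /\ forall v, x (t (col v)) <= x v.
Proof.
have min_ex i : exists u, col u = i /\ forall v, col v = i -> x u <= x v.
  have [v0 v0i] := col_surj i.
  have [u /eqP ui umin] :=
    @arg_minP _ _ _ v0 (fun v => col v == i) x (introT eqP v0i).
  by exists u; split=> // v /eqP; exact: umin.
exists (fun i => sval (cid (min_ex i))); split=> [i|v].
  by case: (cid _) => /= u [].
by case: (cid _) => /= u [_]; exact.
Qed.

Variables (t : 'I_r -> G) (c : 'I_r).
Hypotheses (tK : cancel t col) (t_min : forall v, x (t (col v)) <= x v).
Hypothesis c_min : forall i, x (t c) <= x (t i).

Let F u v := (missing u v)%:R * (x u * x v).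

Let F_ge0 u v : 0 <= F u v.
Proof. by rewrite mulr_ge0 // mulr_ge0 // ltW. Qed.

Lemma sum_ge_term (P : pred G) (f : G -> R) (v : G) :
  (forall u, 0 <= f u) -> P v -> f v <= \sum_(u | P u) f u.
Proof. by move=> f_ge0 Pv; rewrite (bigD1 v) //= lerDl sumr_ge0. Qed.

(* Attach the classes one at a time: each new class [j] brings a missing edge
   of weight at least [x (t c) * x (t j)]. *)
Lemma missing_weight_ge :
  2 * x (t c) * \sum_(i | i != c) x (t i) <= \sum_u \sum_v F u v.
Proof.
pose good (A : {set 'I_r}) := (c \in A) &&
  (2 * x (t c) * \sum_(i in A | i != c) x (t i) <= \sum_(u | col u \in A) \sum_(v | col v \in A) F u v).
have good_c : good [set c].
  rewrite /good set11 big_pred0 => [|i]; last by rewrite inE andbN.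
  by rewrite mulr0 sumr_ge0 // => u _; rewrite sumr_ge0.
have [A /andP[cA A_good] A_max] :=
  @arg_maxnP _ [set c] good (fun A => #|A|) good_c.
suff A_full i : i \in A.
  move: A_good; congr (_ * _ <= _).
    by apply: eq_bigl => i; rewrite A_full.
  apply: eq_big => [u|u _]; first by rewrite A_full.
  by apply: eq_bigl => v; rewrite A_full.
apply: contraT => iA; have [u [v [uA vA uv]]] := missing_boundary cA iA.
set j := col v in vA.
have jc : j != c by apply: contraNneq vA => ->.
suff : good (j |: A).
  by move/A_max; rewrite /= cardsU1 vA add1n ltnn.
have splitA (f : G -> R) : \sum_(w | col w \in j |: A) f w =
    \sum_(w | col w \in A) f w + \sum_(w | col w == j) f w.
  rewrite (bigID (fun w => col w \in A)) /=; congr (_ + _).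
    apply: eq_bigl => w; rewrite in_setU1.
    by case: (_ \in A); rewrite ?andbF ?orbT.
  apply: eq_bigl => w; rewrite in_setU1; have [->|_] := eqVneq (col w) j.
    by rewrite vA.
  by case: (_ \in A).
rewrite /good in_setU1 cA orbT /=.
have -> : \sum_(i0 in j |: A | i0 != c) x (t i0) =
    x (t j) + \sum_(i0 in A | i0 != c) x (t i0).
  rewrite (bigD1 j) /=; last by rewrite setU11.
  congr (_ + _); apply: eq_bigl => k; rewrite in_setU1.
  by have [->|_] := eqVneq k j; rewrite ?(negPf vA) ?andbF ?andbT.
have uv_ge : x (t c) * x (t j) <= F u v.
  rewrite /F uv mul1r.
  apply: ler_pM; [exact: ltW | exact: ltW | | exact: t_min].
  exact: le_trans (c_min _) (t_min u).
have vu_ge : x (t c) * x (t j) <= F v u.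
  by rewrite /F missing_sym [x v * _]mulrC.
(* The two orientations of the missing edge fall in disjoint blocks of the enlarged sum, which gives
   the factor 2. *)
have cross1 : F u v <= \sum_(u | col u \in A) \sum_(v | col v == j) F u v.
  apply: (le_trans _
    (sum_ge_term (f := fun u => \sum_(v | col v == j) F u v) _ uA)).
    by apply: sum_ge_term => //; rewrite eqxx.
  by move=> w; apply: sumr_ge0.
have cross2 : F v u <= \sum_(u | col u == j) \sum_(v | col v \in j |: A) F u v.
  apply: (le_trans _ (sum_ge_term
    (f := fun u => \sum_(v | col v \in j |: A) F u v) (v := v) _ _)).
  - by apply: (sum_ge_term (v := u)) => //; rewrite in_setU1 uA orbT.
  - by move=> w; apply: sumr_ge0.
  - by rewrite eqxx.
rewrite splitA; under [X in _ <= X + _]eq_bigr do rewrite splitA.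
rewrite big_split /=; lra.
Qed.

Variable l : R.
Hypothesis xeig : forall u, \sum_v (adj u v)%:R * x v = l * x u.
Hypothesis star_le : forall y,
  qform (star_minus_rel col t c) y <= l * sqnorm y.

Lemma adj_missing (u v : G) :
  (adj u v)%:R = (col u != col v)%:R - (missing u v)%:R :> R.
Proof.
rewrite /missing; have := @col_proper u v.
by case: (adj u v) => [->|_]; rewrite ?andbT ?subrr ?andbF ?subr0.
Qed.

(** Trading the missing edges for the star does not lower the form at [x], and [l] bounds the star
    form, so [x] is an eigenvector of the star-deleted graph too. Comparing the two eigenvalue
    equations at [u] gives the identity. *)
Lemma missing_sum (u : G) : \sum_v (missing u v)%:R * x v =
  (u == t (col u))%:R *
    (if col u == c then \sum_(i | i != c) x (t i) else x (t c)).
Proof.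
have star_eig :
    forall u, \sum_v (star_minus_rel col t c u v)%:R * x v = l * x u.
  apply: maximizer_eigen (star_minus_sym col t c) (star_minus_irrefl col t c)
    star_le _.
  apply/eqP; rewrite eq_le star_le /= -(qform_eigen xeig) star_minus_qform //.
  rewrite -sum_cross.
  apply: (@le_trans _ _ (\sum_u \sum_v (col u != col v)%:R * (x u * x v) -
      \sum_u \sum_v F u v)).
    rewrite /qform -sumrB; apply: ler_sum => a _.
    rewrite -sumrB; apply: ler_sum => b _.
    by rewrite adj_missing /F; lra.
  by rewrite lerD2l lerN2 missing_weight_ge.
have := star_eig u; rewrite -xeig star_minus_sum //.
rewrite /class_sum [X in _ - X - _]big_mkcond /=.
have -> : \sum_v (adj u v)%:R * x v = \sum_v x v -
    \sum_v (if col v == col u then x v else 0) - \sum_v (missing u v)%:R * x v.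
  rewrite -!sumrB; apply: eq_bigr => v _; rewrite adj_missing eq_sym.
  by case: eqP => _ /=; ring.
lra.
Qed.

(** At a vertex that is not a root the missing weights sum to zero, while all entries are
    positive. *)
Lemma missing_touched (u v : G) : missing u v -> u = t (col u) /\ v = t (col v).
Proof.
have left a b : missing a b -> a = t (col a).
  move=> ab; apply/eqP; apply: contraTT isT => at_neq.
  have := missing_sum a; rewrite (negPf at_neq) mul0r => sum0.
  have : (missing a b)%:R * x b <= 0.
    rewrite -sum0.
    apply: (sum_ge_term (f := fun b => (missing a b)%:R * x b)) => // w.
    by rewrite mulr_ge0 // ltW.
  by rewrite ab mul1r leNgt x_gt0.
by move=> uv; split; [exact: left uv | apply: (left v u); rewrite missing_sym].
Qed.

(** The missing neighbours of a leaf have total weight x(t c), already the least entry of [x]. *)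
Lemma missing_leaf_unique (i : 'I_r) (u v : G) :
  i != c -> missing (t i) u -> missing (t i) v -> u = v.
Proof.
move=> ic iu iv; apply/eqP; case: eqVneq => // uv.
have := missing_sum (t i); rewrite tK (negPf ic) eqxx mul1r.
rewrite (bigD1 u) //= (bigD1 v) /=; last by rewrite eq_sym.
rewrite iu iv !mul1r => sumE.
have rest : 0 <= \sum_(w | (w != u) && (w != v)) (missing (t i) w)%:R * x w.
  by apply: sumr_ge0 => w _; rewrite mulr_ge0 // ltW.
have u_ge : x (t c) <= x u by exact: le_trans (c_min _) (t_min u).
have := x_gt0 v; lra.
Qed.

(** Otherwise the only missing neighbour of [t i] is another leaf [t k], and no missing pair leaves
    the classes i and k, against [missing_boundary]. *)
Lemma missing_center (i : 'I_r) : i != c -> missing (t i) (t c).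
Proof.
move=> ic; apply: contraT => no_ic.
have [v iv] : exists v, missing (t i) v.
  apply: contrapT => none; have := missing_sum (t i).
  rewrite tK (negPf ic) eqxx mul1r big1 => [/esym/eqP|v _].
    by rewrite gt_eqF.
  have [iv|_] := boolP (missing (t i) v); last by rewrite mul0r.
  by case: none; exists v.
have [_ vt] := missing_touched iv; set k := col v in vt.
have kc : k != c by apply: contraNneq no_ic => <-; rewrite -vt.
have [|a [b [+ bA ab]]] := @missing_boundary [set i; k] i c (set21 _ _).
  by rewrite !inE negb_or eq_sym ic eq_sym kc.
have [at_ bt] := missing_touched ab.
rewrite !inE => /orP[] /eqP ai; rewrite ai in at_; rewrite at_ in ab.
  by rewrite (missing_leaf_unique ic ab iv) /k !inE eqxx orbT in bA.
have ki : missing (t k) (t i) by rewrite missing_sym -vt.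
by rewrite (missing_leaf_unique kc ab ki) tK !inE eqxx in bA.
Qed.

Lemma extremal_star (u v : G) : adj u v = star_minus_rel col t c u v.
Proof.
have missingE : missing u v = star_rel col t c u v.
  apply/idP/orP => [uv|].
    have [ut vt] := missing_touched uv; have /andP[uv' _] := uv.
    have [uc|uc] := eqVneq (col u) c.
      by left; rewrite -uc -ut -vt !eqxx eq_sym.
    right; rewrite -ut eqxx andbT; apply/eqP.
    apply: (missing_leaf_unique uc); rewrite -?ut //.
    by rewrite [u in missing u _]ut; apply: missing_center.
  case=> /and3P[/eqP -> /eqP ->]; rewrite tK => vc; last exact: missing_center.
  by rewrite missing_sym missing_center.
rewrite /star_minus_rel -missingE /missing; have := @col_proper u v.
by case: (adj u v) => [->|_] //=; rewrite andbT andbN.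
Qed.

End Extremal.

(** * Graphs on a fixed vertex set and isomorphism invariance *)

Section GraphOfRelation.
Variables (V : finType) (e : rel V).
(** Every relation is turned into a graph, so that the graphs on a fixed vertex type are enumerated
    by finite functions. *)
Definition symmetrized : rel V := fun u v => [&& u != v, e u v & e v u].
Lemma symmetrized_sym : symmetric symmetrized.
Proof. by move=> u v; rewrite /symmetrized eq_sym [e u v && _]andbC. Qed.
Lemma symmetrized_irrefl : irreflexive symmetrized.
Proof. by move=> u; rewrite /symmetrized eqxx. Qed.
Definition graph_of := SGraph symmetrized_sym symmetrized_irrefl.
End GraphOfRelation.

Lemma graph_of_adj (G : sgraph) : graph_of (@adj G) = G.
Proof.
case: G => V e e_sym e_irr; rewrite /graph_of /=.
have eE : symmetrized e = e.
  apply/funext => u; apply/funext => v; rewrite /symmetrized -e_sym andbb.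
  by case: eqVneq => // ->; rewrite e_irr.
move: (@symmetrized_sym V e) (@symmetrized_irrefl V e); rewrite eE => s i.
by rewrite (Prop_irrelevance s e_sym) (Prop_irrelevance i e_irr).
Qed.

Lemma isomorphic_sym (G H : sgraph) : isomorphic G H -> isomorphic H G.
Proof.
move=> [f [g fK gK] fadj]; exists g; first by exists f.
by move=> x y; rewrite -fadj !gK.
Qed.

Section Isomorphism.
Local Open Scope ring_scope.
Variable R : realType.

Lemma isomorphic_radius_le (G H : sgraph) : (0 < #|G|)%N -> isomorphic G H ->
  spectral_radius R G <= spectral_radius R H.
Proof.
move=> G_gt0 [f f_bij fadj].
have f_on : {on [pred _ | true], bijective f} by exact: onW_bij.
have H_gt0 : (0 < #|H|)%N by rewrite -(bij_eq_card f_bij).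
have [x [_ x1 xeig _]] := spectral_radiusP R G_gt0.
have [_ [_ _ _ Hmax]] := spectral_radiusP R H_gt0.
have [g fK gK] := f_bij.
have := Hmax (x \o g).
have -> : sqnorm (x \o g) = 1.
  by rewrite -x1 /sqnorm (reindex f) //=; apply: eq_bigr => v _; rewrite fK.
have -> : qform (@adj H) (x \o g) = spectral_radius R G.
  rewrite -[RHS]mulr1 -x1 -(qform_eigen xeig) /qform (reindex f) //=.
  apply: eq_bigr => u _; rewrite (reindex f) //=.
  by apply: eq_bigr => v _; rewrite !fK fadj.
by rewrite mulr1.
Qed.

Lemma isomorphic_radius (G H : sgraph) : (0 < #|G|)%N -> isomorphic G H ->
  spectral_radius R G = spectral_radius R H.
Proof.
move=> G_gt0 GH; apply/eqP; rewrite eq_le isomorphic_radius_le //=.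
apply: isomorphic_radius_le; last exact: isomorphic_sym.
by have [f /bij_eq_card <-] := GH.
Qed.

End Isomorphism.

Section StarGraph.
Variables (r : nat) (V : finType) (col : V -> 'I_r) (t : 'I_r -> V) (c : 'I_r).

Definition star_minus :=
  SGraph (star_minus_sym col t c) (star_minus_irrefl col t c).

Lemma star_minus_clique_free : clique_free r.+1 star_minus.
Proof.
move=> [f _ f_adj].
have /leq_card : injective (col \o f).
  move=> i j /= ij; apply/eqP; apply: contraT => /f_adj /andP[].
  by rewrite ij eqxx.
by rewrite !card_ord ltnn.
Qed.

(** In the complement each vertex is joined to the root of its class, and each root to the
    centre. *)
Lemma star_minus_co_connected : cancel t col -> co_connected star_minus.
Proof.
move=> tK; split; first by apply/card_gt0P; exists (t c).
have csym : connect_sym (@adj (compl_graph star_minus)).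
  by apply: sym_connect_sym; exact: (@adj_sym (compl_graph star_minus)).
have to_center u : connect (@adj (compl_graph star_minus)) u (t c).
  apply: (@connect_trans _ _ (t (col u))).
    have [<-|ut] := eqVneq u (t (col u)); first exact: connect0.
    apply: connect1; rewrite /= /compl_adj ut /=.
    by rewrite /star_minus_rel tK eqxx.
  have [->|uc] := eqVneq (col u) c; first exact: connect0.
  apply: connect1; rewrite /= /compl_adj /= (inj_eq (can_inj tK)) uc /=.
  by rewrite /star_minus_rel /star_rel !tK !eqxx uc orbT andbF.
by move=> u v; apply: connect_trans (to_center u) _; rewrite csym.
Qed.

End StarGraph.

(** * Extremal graphs among the co-connected clique-free ones *)

Section Maximal.
Local Open Scope ring_scope.
Variables (R : realType) (r n : nat).
Hypotheses (r_ge2 : (2 <= r)%N) (n_ge : (65 * r ^ 2 <= n)%N).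

Definition admissible (G : sgraph) := co_connected G /\ clique_free r.+1 G.

Lemma radius_lower_bound (l m k : R) : 2 <= k -> 65 * k ^+ 2 <= m ->
  (1 - k^-1) * m ^+ 2 - 9 / 4 * k <= l * m -> m / 3 <= l.
Proof.
move=> k2 m65 lm; have m_gt : 130 * k <= m by nra.
have m_gt0 : 0 < m by lra.
have kV : k^-1 <= 2^-1 by rewrite lef_pV2 // posrE; lra.
have : 0 <= (2^-1 - k^-1) * m ^+ 2 by rewrite mulr_ge0 ?sqr_ge0 // subr_ge0.
move=> h; rewrite -(ler_pM2r m_gt0); nra.
Qed.

Lemma radius_ge1 (l m k : R) :
  2 <= k -> 65 * k ^+ 2 <= m -> m / 3 <= l -> 1 <= l.
Proof.
move=> k2 m65 ml; have m_gt : 130 * k <= m by nra.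
by lra.
Qed.

(** Supplies the smallness of [Q] for [balance_gain]: l >= 40 k gives Q l <= 1 / 40, and with l + q
    <= 4 l and Q <= 1 the product is at most 12 Q l. *)
Lemma star_weight_bound (l m k q Q : R) : 2 <= k -> 65 * k ^+ 2 <= m ->
  m / 3 <= l -> 0 <= q <= m -> 0 <= Q -> Q * l ^+ 2 <= k ->
  (2 * Q + Q ^+ 2) * (l + q) <= 2.
Proof.
move=> k2 m65 ml /andP[q0 qm] Q0 Ql; have m_gt : 130 * k <= m by nra.
have l_gt : 40 * k <= l by lra.
have l_gt0 : 0 < l by lra.
have Ql1 : Q * l <= 1 / 40.
  rewrite -(ler_pM2r l_gt0) -mulrA -expr2; apply: le_trans Ql _; lra.
have Q1 : Q <= 1 by nra.
have : (2 * Q + Q ^+ 2) * (l + q) <= (3 * Q) * (4 * l).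
  by apply: ler_pM; nra.
by lra.
Qed.

Lemma maximal_isomorphic (G : sgraph) : #|G| = n -> admissible G ->
  (forall G' : sgraph, vertex G' = vertex G -> admissible G' ->
     spectral_radius R G' <= spectral_radius R G) ->
  spectral_radius R (turan_minus r n) <= spectral_radius R G ->
  isomorphic G (turan_minus r n).
Proof.
move=> G_order [G_coconn G_free] G_max TG.
set l := spectral_radius R G in TG G_max.
have r_gt0 : (0 < r)%N by exact: leq_trans r_ge2.
have r_le_n : (r <= n)%N.
  by apply: leq_trans n_ge; rewrite expnS expn1 mulnA leq_pmull // muln_gt0.
have n_gt0 : (0 < n)%N by exact: leq_trans r_le_n.
have G_gt0 : (0 < #|G|)%N by rewrite G_order.
have nR_gt0 : 0 < n%:R :> R by rewrite ltr0n.
have r2R : 2 <= r%:R :> R by rewrite ler_nat.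
have n65R : 65 * r%:R ^+ 2 <= n%:R :> R by rewrite -natrX -natrM ler_nat.
have l_ge : (1 - r%:R^-1) * n%:R ^+ 2 - 9 / 4 * r%:R <= l * n%:R.
  apply: le_trans (turan_minus_radius R r_gt0 r_le_n) _.
  by rewrite ler_pM2r.
have l_ge3 := radius_lower_bound r2R n65R l_ge.
have [x0 [x0_ge0 x01 x0eig lmax]] := spectral_radiusP R G_gt0.
have sqn_gt0 : 0 < Num.sqrt (n%:R : R) by rewrite sqrtr_gt0.
(* Squared norm n brings the mean entry close to 1. *)
pose x v := Num.sqrt n%:R * x0 v.
have x_ge0 v : 0 <= x v by rewrite mulr_ge0 // ltW.
have x_norm : sqnorm x = n%:R by rewrite sqnormZ x01 mulr1 sqr_sqrtr // ltW.
have xeig u : \sum_v (adj u v)%:R * x v = l * x u.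
  rewrite /x mulrCA -x0eig mulr_sumr; apply: eq_bigr => v _; ring.
have x_form : qform (@adj G) x = l * n%:R by rewrite (qform_eigen xeig) x_norm.
have [col [col_proper x_ge col_surj]] :=
  near_turan r_ge2 n_ge G_order G_free x_ge0 x_norm x_form l_ge.
have x_gt0 v : 0 < x v by apply: lt_le_trans (x_ge v); lra.
have [t [tK t_min]] := exists_min_transversal col_surj x.
have [c _ c_min] :=
  @arg_minP _ _ _ (Ordinal r_gt0) xpredT (fun i => x (t i)) isT.
have {}c_min i : x (t c) <= x (t i) by exact: c_min.
(* The star-deleted graph is admissible on the same vertices, so the maximality of [G] applies to
   it. *)
have star_le y : qform (star_minus_rel col t c) y <= l * sqnorm y.
  have [_ [_ _ _ starmax]] := @spectral_radiusP R (star_minus col t c) G_gt0.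
  apply: le_trans (starmax y) _; apply: ler_wpM2r; first exact: sqnorm_ge0.
  apply: G_max => //; split; last exact: star_minus_clique_free.
  exact: star_minus_co_connected.
have adjE := extremal_star G_coconn col_proper col_surj x_gt0 tK t_min c_min
  xeig star_le.
have [topE sizeE] := turan_top_size r_gt0 r_le_n.
set q := _.-1 in topE sizeE.
pose S := \sum_v x v.
have [v0 _] := card_gt0P G_gt0.
have S_gt0 : 0 < S.
  by rewrite /S (bigD1 v0) //= ltr_pwDl // sumr_ge0.
pose y v := S^-1 * x v.
have y1 : \sum_v y v = 1 by rewrite -mulr_sumr mulVf // gt_eqF.
have y_ge0 v : 0 <= y v by rewrite mulr_ge0 // invr_ge0 ltW.
have yeig u : \sum_v (star_minus_rel col t c u v)%:R * y v = l * y u.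
  rewrite /y mulrCA -xeig mulr_sumr; apply: eq_bigr => v _.
  by rewrite adjE; ring.
have l_gt0 : 0 < l by lra.
have y_le v : l * y v <= 1.
  rewrite -[leRHS]y1 -yeig; apply: ler_sum => w _.
  by case: (star_minus_rel _ _ _ _ _); rewrite ?mul1r ?mul0r.
have y_min i : y (t c) <= y (t i) by rewrite ler_wpM2l // invr_ge0 ltW.
pose P := \sum_(i | i != c) y (t i).
have P_ge0 : 0 <= P by exact: sumr_ge0.
(* Since r >= 2 there is a leaf, whose entry is at least that of the centre. *)
have yc_le : y (t c) <= P.
  have /card_gt0P[j jc] : (0 < #|predC1 c|)%N.
    by rewrite cardC1 card_ord -subn1 subn_gt0.
  by rewrite /P (bigD1 j) //=; apply: ler_wpDr; rewrite ?sumr_ge0.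
(* Each of the r - 1 leaves satisfies l y(t i) <= 1. *)
have Pl : P / l * l ^+ 2 <= r%:R.
  have -> : P / l * l ^+ 2 = \sum_(i | i != c) l * y (t i).
    by rewrite -mulr_sumr -/P; field; rewrite gt_eqF.
  apply: (@le_trans _ _ (\sum_(i | i != c) 1)); first exact: ler_sum.
  by rewrite sumr_const cardC1 card_ord ler_nat leq_pred.
have q_le : 0 <= (q%:R : R) <= n%:R.
  rewrite ler0n ler_nat -(turan_size_sum n r_gt0).
  rewrite (bigD1 (turan_top r_gt0)) //= topE.
  by rewrite (leq_trans (leqnSn q)) // leq_addr.
have Q_le := star_weight_bound r2R n65R l_ge3 q_le
  (divr_ge0 P_ge0 (ltW l_gt0)) Pl.
have T_order := card_turan_minus n r_gt0.
have turanE : @adj (turan_minus r n) =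
    star_minus_rel (@turan_class r n) (turan_root r_gt0 r_le_n)
      (turan_top r_gt0).
  by apply/funext => u; apply/funext => v; exact: turan_minus_star.
have turan_le z : qform (star_minus_rel (@turan_class r n)
    (turan_root r_gt0 r_le_n) (turan_top r_gt0)) z <= l * sqnorm z.
  have [|_ [_ _ _ Tmax]] := @spectral_radiusP R (turan_minus r n).
    by rewrite T_order.
  rewrite -turanE; apply: le_trans (Tmax z) _.
  by apply: ler_wpM2r; first exact: sqnorm_ge0.
have l_ge1 := radius_ge1 r2R n65R l_ge3.
have VT : #|G| = #|turan_minus r n| by rewrite T_order.
have tsizeE i : class_size (@turan_class r n) i = q \/
    class_size (@turan_class r n) i = q.+1.
  by rewrite turan_class_size.
have ttopE : class_size (@turan_class r n) (turan_top r_gt0) = q.+1.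
  by rewrite turan_class_size.
have yc : 0 <= y (t c) <= P by rewrite y_ge0.
have [sizec sizes] := star_compare tK (turan_rootK r_gt0 r_le_n) l_gt0 y1 yeig
  l_ge1 VT yc Q_le tsizeE ttopE turan_le.
have [h h_bij hE] := star_minus_iso tK (turan_rootK r_gt0 r_le_n) VT sizes
  tsizeE sizec.
by exists h => // u v; rewrite adjE turanE hE.
Qed.

(** The graphs on a given vertex type are finitely many up to their proof fields, which proof
    irrelevance identifies. *)
Lemma exists_maximal (G : sgraph) : admissible G ->
  exists G0 : sgraph, [/\ vertex G0 = vertex G, admissible G0 &
    forall G' : sgraph, vertex G' = vertex G -> admissible G' ->
      spectral_radius R G' <= spectral_radius R G0].
Proof.
move=> G_adm.
pose gr (f : {ffun G * G -> bool}) := graph_of (fun u v : G => f (u, v)).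
have grE (G' : sgraph) : vertex G' = vertex G -> exists f, gr f = G'.
  case: G' => V e e_sym e_irr /= VG; subst V.
  exists [ffun p => e p.1 p.2]; rewrite /gr -[RHS]graph_of_adj /=.
  by congr graph_of; apply/funext => u; apply/funext => v; rewrite ffunE.
have [f0 f0E] := grE G erefl.
pose ok f := `[< admissible (gr f) >].
have f0ok : ok f0 by apply/asboolP; rewrite f0E.
have [f /asboolP f_ok f_max] :=
  @arg_maxP _ _ _ f0 ok (fun f => spectral_radius R (gr f)) f0ok.
exists (gr f); split=> // G' VG' G'_adm.
have [f' f'E] := grE G' VG'; rewrite -f'E; apply: f_max.
by apply/asboolP; rewrite f'E.
Qed.

End Maximal.

Theorem theorem4p1 (R : realType) (r n : nat) (G : sgraph)
    (r_ge2 : (2 <= r)%N) (n_ge : (65 * r ^ 2 <= n)%N)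
    (G_order : #|G| = n)
    (G_coconn : co_connected G)
    (G_free : clique_free r.+1 G) :
  (spectral_radius R G <= spectral_radius R (turan_minus r n))%R /\
  (spectral_radius R G = spectral_radius R (turan_minus r n) <->
   isomorphic G (turan_minus r n)).
Proof.
have [G_gt0 _] := G_coconn.
have [G0 [VG0 G0_adm G0_max]] := exists_maximal R (conj G_coconn G_free).
have G_le := G0_max G erefl (conj G_coconn G_free).
have G0_order : #|G0| = n by rewrite VG0.
have G0_gt0 : 0 < #|G0| by rewrite G0_order -G_order.
(* A maximal graph beating T_r^-(n) would be isomorphic to it, hence have the same radius. *)
have G0_le : (spectral_radius R G0 <= spectral_radius R (turan_minus r n))%R.
  case: (lerP (spectral_radius R G0) (spectral_radius R (turan_minus r n))) =>
    // TG0.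
  have G0T : isomorphic G0 (turan_minus r n).
    apply: (maximal_isomorphic r_ge2 n_ge G0_order G0_adm _ (ltW TG0)) => G'.
    by rewrite VG0; exact: G0_max.
  by rewrite (isomorphic_radius R G0_gt0 G0T) ltxx in TG0.
split; first exact: le_trans G_le G0_le.
split=> [GT|]; last exact: isomorphic_radius.
(* In the equality case [G] attains the upper bound for [G0], so it is itself maximal. *)
apply: (@maximal_isomorphic R r n) => //; last by rewrite GT.
by move=> G' VG' G'_adm; rewrite (le_trans (G0_max G' VG' G'_adm)) // GT.
Qed.
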